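(* Let $a_1,a_2,b_{11},b_{22},\sigma_1,\sigma_2>0$ and $b_{12},b_{21}\ge 0$, let $A=(a_1,a_2)^{\mathrm T}$, and let $(Q_t)_{t\ge 0}$ be the transition semigroup of the two-type continuous-state branching process with immigration on $\mathbf D=[0,\infty)^2$ with these parameters, with associated functions $v_t(\lambda)$ (see context). Suppose both eigenvalues of $$B=\begin{pmatrix} b_{11} & -b_{12}\\ -b_{21} & b_{22}\end{pmatrix}$$ are positive, i.e. $\kappa:=\frac{b_{12}b_{21}}{b_{11}b_{22}}<1$. Then $(Q_t)_{t\ge 0}$ has a unique stationary distribution $Q_\infty$, and it is given by $$\int_{\mathbf D}e^{-\langle y,\lambda\rangle}\,Q_\infty(dy)=\exp\Big\{-\int_0^\infty\langle A,v_s(\lambda)\rangle\,ds\Big\},\qquad \lambda\in\mathbf D.$$ Moreover, for every $x\in\mathbf D$, $Q_t(x,\cdot)\to Q_\infty$ weakly as $t\to\infty$.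
   Context: $\langle\cdot,\cdot\rangle$ is the Euclidean inner product on $\mathbb R^2$. For $\lambda\in\mathbf D=[0,\infty)^2$, $v_t(\lambda)=(v_1(t,\lambda),v_2(t,\lambda))^{\mathrm T}\in\mathbf D$, $t\ge0$, denotes the unique solution of $$\frac{\partial}{\partial t}v_1(t,\lambda)=-b_{11}v_1(t,\lambda)+b_{12}v_2(t,\lambda)-\frac{\sigma_1^2}{2}v_1(t,\lambda)^2,$$ $$\frac{\partial}{\partial t}v_2(t,\lambda)=b_{21}v_1(t,\lambda)-b_{22}v_2(t,\lambda)-\frac{\sigma_2^2}{2}v_2(t,\lambda)^2,$$ with $v_0(\lambda)=\lambda$. The two-type continuous-state branching process with immigration (CBI-process) with these parameters is the Markov process in $\mathbf D$ whose transition semigroup $(Q_t)_{t\ge0}$ is determined by $$\int_{\mathbf D}e^{-\langle y,\lambda\rangle}Q_t(x,dy)=\exp\Big\{-\langle x,v_t(\lambda)\rangle-\int_0^t\langle A,v_s(\lambda)\rangle ds\Big\},\qquad \lambda,x\in\mathbf D.$$ A stationary distribution is a probability measure $\mu$ on $\mathbf D$ with $\int \mu(dx)Q_t(x,\cdot)=\mu$ for all $t\ge 0$. *)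

(* Defs.v *)
From HB Require Import structures.
From mathcomp Require Import all_boot all_order all_algebra.
From mathcomp Require Import all_classical all_reals all_analysis.

Set Implicit Arguments.
Unset Strict Implicit.
Unset Printing Implicit Defensive.

Import Order.TTheory GRing.Theory Num.Theory.
Import numFieldNormedType.Exports.

Local Open Scope classical_set_scope.
Local Open Scope ring_scope.

Definition orthant (R : realType) : set (R * R) :=
  [set x | 0 <= x.1 /\ 0 <= x.2].

Definition dotp (R : realType) (x y : R * R) : R := x.1 * y.1 + x.2 * y.2.

(* Derivative at [t >= 0] of a function that only matters on [0, +oo[:
   two-sided for [t > 0], from the right for [t = 0]. *)
Definition derive_on_nneg (R : realType) (f : R -> R) (t l : R) : Prop :=
  (s - t)^-1 * (f s - f t) @[s --> within `[0, +oo[ t^'] --> l.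

(* [w] is the solution on [0, +oo[, with values in the quadrant D = [orthant], of
   the Riccati system started at [l]; its values at negative times are
   irrelevant. *)
Definition is_cumulant_solution (R : realType)
    (b11 b12 b21 b22 s1 s2 : R) (l : R * R) (w : R -> R * R) : Prop :=
  w 0 = l /\
  forall t : R, 0 <= t ->
    [/\ orthant (w t),
        derive_on_nneg (fun s => (w s).1) t
          (- b11 * (w t).1 + b12 * (w t).2 - s1 ^+ 2 / 2 * (w t).1 ^+ 2) &
        derive_on_nneg (fun s => (w s).2) t
          (b21 * (w t).1 - b22 * (w t).2 - s2 ^+ 2 / 2 * (w t).2 ^+ 2)].

(* For [0 <= b12 * b21] both eigenvalues are real, so the positivity of the
   eigenvalues can be expressed over [R] itself. *)
Definition drift_mx (R : realType) (b11 b12 b21 b22 : R) : 'M[R]_2 :=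
  \matrix_(i, j)
    if i == ord0 then (if j == ord0 then b11 else - b12)
                 else (if j == ord0 then - b21 else b22).

Definition laplace (R : realType) (mu : {measure set (R * R)%type -> \bar R})
    (l : R * R)
    : \bar R :=
  (\int[mu]_(y in @orthant R) (expR (- dotp y l))%:E)%E.

(* A Markov semigroup on D is represented by kernels on R * R of which only the
   part with [0 <= t] and starting point in D is constrained or used. *)
Definition is_markov_semigroup (R : realType)
    (Q : R -> R.-pker (R * R) ~> (R * R)%type) : Prop :=
  [/\ forall (t : R) x, 0 <= t -> orthant x -> Q t x (@orthant R) = 1%E,
      forall x U, orthant x -> measurable U -> Q 0 x U = \d_x U &
      forall (s t : R) x U, 0 <= s -> 0 <= t -> orthant x -> measurable U ->
        Q (s + t) x U = (\int[Q s x]_(y in @orthant R) Q t y U)%E].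

(* The time integral is taken in the extended reals, with exp(-oo) = 0, so that
   no integrability is presupposed. *)
Definition is_cbi_semigroup (R : realType) (A : R * R)
    (v : R -> R * R -> R * R)
    (Q : R -> R.-pker (R * R) ~> (R * R)%type) : Prop :=
  is_markov_semigroup Q /\
  forall (t : R) (x l : R * R), 0 <= t -> orthant x -> orthant l ->
    laplace (Q t x) l =
    expeR (- (dotp x (v t l))%:E
           - \int[@lebesgue_measure R]_(s in `[0%R, t]) (dotp A (v s l))%:E)%E.

(* Set functions in the library have irrelevant values off the sigma-algebra,
   hence measures are compared on measurable sets only. *)
Definition is_stationary (R : realType)
    (Q : R -> R.-pker (R * R) ~> (R * R)%type)
    (mu : probability (R * R)%type R) : Prop :=
  mu (@orthant R) = 1%E /\
  forall (t : R) (U : set (R * R)), 0 <= t -> measurable U ->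
    (\int[mu]_(x in @orthant R) Q t x U)%E = mu U.

(* Weak convergence of measures on D, tested on bounded continuous functions
   on D. *)
Definition converges_weakly (R : realType)
    (nu : R -> {measure set (R * R)%type -> \bar R})
    (mu : {measure set (R * R)%type -> \bar R}) : Prop :=
  forall f : R * R -> R,
    {within @orthant R, continuous f} ->
    (exists M : R, forall x, orthant x -> `|f x| <= M) ->
    (\int[nu t]_(x in @orthant R) f x)%R @[t --> +oo]
      --> (\int[mu]_(x in @orthant R) f x)%R.

(* Main.v *)
Require Import Defs.
From HB Require Import structures.
From mathcomp Require Import all_boot all_order all_algebra.
From mathcomp Require Import all_classical all_reals all_analysis.
From mathcomp Require Import measurable_realfun ring lra.

(* Let [c] solve [c B = A].  Since the Riccati nonlinearity is dissipative,
   [<c, v_t>' <= - <A, v_t>], so [\int_0^oo <A, v_s(l)> ds <= <c, l>] and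
   [v_t(l) -> 0].  Hence the Laplace transforms of [Q_t(x, .)] converge to a
   limit that is continuous at 0 and does not depend on [x].

   Such a convergence determines the limit of [\int f dQ_t(x, .)] for every
   bounded continuous [f]: cut off [f], and approximate it uniformly by
   polynomials in [exp(-y_1)] and [exp(-y_2)] (Bernstein).  The limit is a
   positive tight functional of [f]; the outer measure that it induces makes the
   Borel sets measurable and represents it, which yields [Qinf] and the weak
   convergence.  The same approximation shows that the Laplace transform
   determines a probability measure on the quadrant.

   Finally, Chapman-Kolmogorov at [x = 0] gives
   [\int_0^(t+s) <A, v_u(l)> du
    = \int_0^t <A, v_u(l)> du + \int_0^s <A, v_u(v_t(l))> du];
   letting [s] tend to infinity, the Laplace transform of [Qinf] is seen to be
   invariant under [Q_t].  That of any other stationary measure is forced by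
   [v_t(l) -> 0] and dominated convergence. *)

Set Implicit Arguments.
Unset Strict Implicit.
Unset Printing Implicit Defensive.

Import Order.TTheory GRing.Theory Num.Theory.
Import numFieldNormedType.Exports.

Local Open Scope classical_set_scope.
Local Open Scope ring_scope.

(** * Approximation by exponential polynomials *)

Lemma continuous_pair (T U V : topologicalType) (f : T -> U) (g : T -> V) :
  continuous f -> continuous g -> continuous (fun x => (f x, g x)).
Proof. by move=> cf cg x; apply: (cvg_pair (cf x) (cg x)). Qed.

(** * Bernstein operators on the unit square *)

Section Bernstein.
Variable R : realType.
Implicit Types (u w a c C e : R) (n : nat) (phi psi : nat -> R).

(* The expectation of [phi] under the binomial law with parameters [n] and [u],
   computed by conditioning on one trial at a time. *)
Fixpoint bern u n phi : R :=
  if n is m.+1 then (1 - u) * bern u m phi + u * bern u m (phi \o succn)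
  else phi 0%N.

(** Each step of the recursion is a convex combination, so the triangle inequality passes through
    it. Only the values of [phi] at [0, ..., n] enter. *)
Lemma bern_dist u n phi psi a : 0 <= u <= 1 ->
  (forall k, (k <= n)%N -> `|phi k - a| <= psi k) ->
  `|bern u n phi - a| <= bern u n psi.
Proof.
move=> /andP[u0 u1]; elim: n phi psi => [|n IH] phi psi H /=; first exact: H.
have H1 := IH phi psi (fun k kn => H k (leqW kn)).
have H2 := IH (phi \o succn) (psi \o succn) (fun k kn => H k.+1 kn).
rewrite (_ : _ - a = (1 - u) * (bern u n phi - a)
                     + u * (bern u n (phi \o succn) - a)); last by ring.
apply: (le_trans (ler_normD _ _)).
by rewrite !normrM (ger0_norm u0) (@ger0_norm _ (1 - u)) ?subr_ge0// lerD//
  ler_wpM2l// subr_ge0.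
Qed.

(** Second moment as variance plus squared bias. The centre [c] is kept general because the shift by
    [succn] turns it into [c - 1] in the induction. *)
Lemma bern_sqr u n a C c :
  bern u n (fun k => a + C * (k%:R - c) ^+ 2) =
  a + C * (n%:R * u * (1 - u) + (n%:R * u - c) ^+ 2).
Proof.
elim: n c => [|n IH] c /=; first by ring.
rewrite IH (_ : _ \o _ = fun k => a + C * (k%:R - (c - 1)) ^+ 2).
  by rewrite IH -natr1; ring.
by apply/funext => k /=; rewrite -natr1; congr (_ + _ * _ ^+ 2); ring.
Qed.

Lemma bern_variance u n a C : (0 < n)%N ->
  bern u n (fun k => a + C * (k%:R / n%:R - u) ^+ 2) = a + C * (u * (1 - u) / n%:R).
Proof.
move=> n0; have nN : n%:R != 0 :> R by rewrite pnatr_eq0 -lt0n.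
rewrite (_ : (fun k => _) =
    (fun k => a + C / n%:R ^+ 2 * (k%:R - n%:R * u) ^+ 2)).
  by rewrite bern_sqr; field.
by apply/funext => k; field.
Qed.

(** Nearby points differ by at most [e] by continuity; for distant points the quadratic term exceeds
    [2 * M]. Compactness of the square gives one [C] for all [p]. A quadratic bound is wanted
    because its binomial mean is explicit. *)
Lemma quadratic_modulus (g : R * R -> R) (M e : R) :
  continuous g -> (forall x, `|g x| <= M) -> 0 < e ->
  exists C, 0 <= C /\ forall p q : R * R,
    0 <= p.1 <= 1 -> 0 <= p.2 <= 1 ->
    `|g p - g q| <= e + C * ((p.1 - q.1) ^+ 2 + (p.2 - q.2) ^+ 2).
Proof.
move=> cg gM e0.
pose K := (`[0, 1] `*` `[0, 1])%classic : set (R * R).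
have cK : compact K by apply: compact_setX; exact: segment_compact.
pose P (C : R) (p : R * R) := forall q : R * R,
  `|g p - g q| <= e + C * ((p.1 - q.1) ^+ 2 + (p.2 - q.2) ^+ 2).
have M0 : 0 <= M := le_trans (normr_ge0 _) (gM (0, 0)).
have : \forall C \near +oo, K `<=` P C.
  apply: (proj1 (compact_near_coveringP K) cK) => x Kx.
  have /cvgrPdist_lt /(_ (e / 2)) := cg x.
  rewrite divr_gt0// => /(_ isT)/nbhs_ballP[d /= d0 dg].
  have d20 : 0 < d / 2 by rewrite divr_gt0.
  (* With half the radius, any [q] within [d / 2] of [p] is still within [d] of [x]. The threshold
     on [C] makes the quadratic term at least [2 * M] for every other [q]. *)
  exists (ball x (d / 2), [set C | 2 * M / (d / 2) ^+ 2 <= C]) => /=.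
    split; first exact: nbhsx_ballx.
    exact: nbhs_pinfty_ge (num_real _).
  move=> [p C] /= [xp MC] q.
  have C0 : 0 <= C.
    by apply: le_trans MC; apply: divr_ge0; [exact: mulr_ge0|exact: sqr_ge0].
  have S0 : 0 <= (p.1 - q.1) ^+ 2 + (p.2 - q.2) ^+ 2.
    by rewrite addr_ge0 ?sqr_ge0.
  have gp : `|g x - g p| < e / 2.
    by apply: dg; apply: le_ball xp; lra.
  have [pq|pq] := pselect (ball p (d / 2) q).
    have gq : `|g x - g q| < e / 2.
      by apply: dg; rewrite [d]splitr; exact: ball_triangle xp pq.
    have : 0 <= C * ((p.1 - q.1) ^+ 2 + (p.2 - q.2) ^+ 2) by exact: mulr_ge0.
    by move: gp gq; rewrite !ltr_norml !ler_norml; lra.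
  have : (d / 2) ^+ 2 <= (p.1 - q.1) ^+ 2 + (p.2 - q.2) ^+ 2.
    rewrite leNgt; apply/negP => pqd; apply: pq; split => /=;
      rewrite /ball /= -(ltr_pXn2r (n := 2)) ?nnegrE ?normr_ge0 1?ltW//
        real_normK ?num_real//; apply: le_lt_trans pqd.
      by rewrite lerDl sqr_ge0.
    by rewrite lerDr sqr_ge0.
  move=> /(ler_wpM2l C0) H.
  have : 2 * M <= C * (d / 2) ^+ 2 by rewrite -ler_pdivrMr ?exprn_gt0.
  move: (gM p) (gM q); rewrite !ler_norml; lra.
move=> H; have : \forall C \near +oo, K `<=` P C /\ 0 <= C.
  near=> C; split; first by near: C.
  by near: C; exact: nbhs_pinfty_ge (num_real _).
move=> /filter_ex [C [KP C0]]; exists C; split=> // p q p1 p2.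
by apply: KP; split => /=; rewrite in_itv.
Unshelve. all: by end_near. Qed.

(** Average the quadratic modulus, taken with [e / 2], under both binomial laws: each variance term
    is at most [C / n], hence at most [e / 4] by the choice of [n]. *)
Lemma bernstein_approx (g : R * R -> R) (M e : R) :
  continuous g -> (forall x, `|g x| <= M) -> 0 < e ->
  exists n, forall u w, 0 <= u <= 1 -> 0 <= w <= 1 ->
    `|bern u n (fun j => bern w n (fun k => g (j%:R / n%:R, k%:R / n%:R)))
       - g (u, w)| <= e.
Proof.
move=> cg gM e0.
have [C [C0 gC]] := quadratic_modulus cg gM (divr_gt0 e0 (ltr0n _ 2)).
have [n [n0 nC]] : exists n, (0 < n)%N /\ 4 * C / e < n%:R.
  by exists (Num.truncn (4 * C / e)).+1; split=> //; exact: Num.Theory.truncnS_gt.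
have nR : 0 < n%:R :> R by rewrite ltr0n.
exists n => u w u01 w01.
apply: le_trans.
  (* The inner average over [k] leaves the variance in [w] as a constant, together with the
     quadratic term in [j] that the outer average treats next. *)
  apply: (bern_dist (psi := fun j => (e / 2 + C * (w * (1 - w) / n%:R))
      + C * (j%:R / n%:R - u) ^+ 2)) => // j jn.
  rewrite addrAC -(bern_variance w _ C n0).
  apply: bern_dist => // k kn.
  rewrite distrC (le_trans (gC (u, w) (j%:R / n%:R, k%:R / n%:R) u01 w01))//=.
  by rewrite -addrA -mulrDr sqrrB [in leRHS]sqrrB lerD2l ler_wpM2l//; lra.
rewrite bern_variance//.
have H x : 0 <= x <= 1 -> C * (x * (1 - x) / n%:R) <= e / 4.
  move=> /andP[x0 x1]; rewrite mulrA ler_pdivrMr//.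
  have : x * (1 - x) <= 1 by nra.
  move=> /(ler_wpM2l C0); rewrite mulr1 => /le_trans; apply.
  by move: nC; rewrite ltr_pdivrMr// => nC; lra.
move: (H u u01) (H w w01); lra.
Qed.

End Bernstein.

(** * Density of exponential polynomials *)

Section ExponentialPolynomials.
Variable R : realType.
Implicit Types (f g P : R * R -> R) (y : R * R).

Definition expmono (j k : nat) y : R := expR (- dotp y (j%:R, k%:R)).

(** Being inductive, the predicate lets equality or convergence of linear functionals pass from
    monomials to all exponential polynomials. *)
Inductive expoly : (R * R -> R) -> Prop :=
| expoly_mono c j k : expoly (fun y => c * expmono j k y)
| expolyD P1 P2 : expoly P1 -> expoly P2 -> expoly (fun y => P1 y + P2 y).

Lemma expmonoM j k j' k' y :
  expmono j k y * expmono j' k' y = expmono (j + j') (k + k') y.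
Proof. by rewrite /expmono -expRD /dotp /= !natrD; congr expR; ring. Qed.

Lemma expolyM P1 P2 : expoly P1 -> expoly P2 -> expoly (fun y => P1 y * P2 y).
Proof.
move=> H1; elim: H1 P2 => [c j k P2|Q1 Q2 _ IH1 _ IH2 P2 HP2]; last first.
  under eq_fun do rewrite mulrDl.
  by apply: expolyD; [exact: IH1|exact: IH2].
elim=> [c' j' k'|Q1 Q2 _ IH1 _ IH2].
  under eq_fun do rewrite mulrACA expmonoM.
  exact: expoly_mono.
by under eq_fun do rewrite mulrDr; exact: expolyD.
Qed.

Lemma expoly_cst c : expoly (fun=> c).
Proof.
rewrite (_ : (fun=> c) = (fun y => c * expmono 0 0 y)); first exact: expoly_mono.
by apply/funext => y; rewrite /expmono /dotp /= !mulr0 addr0 oppr0 expR0 mulr1.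
Qed.

(** The coefficients [phi k] may themselves be exponential polynomials, so that the operator can be
    nested over the two coordinates. *)
Lemma expoly_bern (U : R * R -> R) n (phi : nat -> R * R -> R) :
  expoly U -> (forall k, expoly (phi k)) ->
  expoly (fun y => bern (U y) n (fun k => phi k y)).
Proof.
move=> eU; elim: n phi => [|n IH] phi ephi /=; first exact: ephi.
apply: expolyD; last by apply: expolyM => //; apply: (IH (fun k => phi k.+1)).
apply: expolyM; last exact: IH.
apply: expolyD; first exact: expoly_cst.
under eq_fun do rewrite -mulN1r.
by apply: expolyM => //; exact: expoly_cst.
Qed.

(* [g] extends [f] through the coordinates [u = exp (- y)]; the truncation of
   [u] from below at [c] is invisible on the support of [f]. *)
Lemma expoly_dense f (M N e : R) :
  continuous f -> (forall y, orthant y -> `|f y| <= M) ->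
  (forall y, orthant y -> N <= y.1 \/ N <= y.2 -> f y = 0) -> 0 <= N -> 0 < e ->
  exists P, expoly P /\ forall y, orthant y -> `|P y - f y| <= e.
Proof.
move=> cf fM f0 N0 e0.
pose c := expR (- N).
pose L (u : R) := Num.max 0 (- ln (Num.max u c)).
have c0 : 0 < c by exact: expR_gt0.
have cL : continuous L.
  move=> u; apply: (@continuous_max _ _ (fun=> 0) (fun u => - ln (Num.max u c))).
    exact: cvg_cst.
  apply: cvgN; apply: (@continuous_comp _ _ _ (fun u => Num.max u c) (@ln R)).
    by apply: continuous_max; [exact: cvg_id|exact: cvg_cst].
  by apply: continuous_ln; rewrite lt_max c0 orbT.
pose g (p : R * R) := f (L p.1, L p.2).
have cg : continuous g.
  move=> p; apply: (@continuous_comp _ _ _ (fun p : R * R => (L p.1, L p.2)) f);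
    last exact: cf.
  apply: continuous_pair => q.
    by apply: (@continuous_comp _ _ _ fst L); [exact: cvg_fst|exact: cL].
  by apply: (@continuous_comp _ _ _ snd L); [exact: cvg_snd|exact: cL].
have gM p : `|g p| <= M.
  by apply: fM; split; rewrite /= le_max lexx.
have [n Hn] := bernstein_approx cg gM e0.
have EL (x : R) : 0 <= x -> L (expR (- x)) = Num.min x N.
  move=> x0; rewrite /L /c; case: (leP x N) => xN.
    by rewrite (@max_l _ _ (expR _)) ?expRK ?opprK ?max_r// ler_expR lerN2.
  by rewrite (@max_r _ _ (expR _)) ?expRK ?opprK ?max_r// ler_expR lerN2 ltW.
exists (fun y => bern (expmono 1 0 y) n (fun j => bern (expmono 0 1 y) n
          (fun k => g (j%:R / n%:R, k%:R / n%:R)))); split.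
  have em j k : expoly (expmono j k).
    rewrite (_ : expmono j k = (fun y => 1 * expmono j k y)); first exact: expoly_mono.
    by apply/funext => y; rewrite mul1r.
  apply: (@expoly_bern _ _ (fun j y => bern (expmono 0 1 y) n (fun k => _))) => // j.
  apply: (@expoly_bern _ _ (fun k y => g _)) => // k; exact: expoly_cst.
move=> y [y1 y2].
have e1 : expmono 1 0 y = expR (- y.1) by rewrite /expmono /dotp /= mulr1 mulr0 addr0.
have e2 : expmono 0 1 y = expR (- y.2) by rewrite /expmono /dotp /= mulr1 mulr0 add0r.
have E01 (x : R) : 0 <= x -> 0 <= expR (- x) <= 1.
  by move=> x0; rewrite expR_ge0 -expR0 ler_expR oppr_le0.
have fg : g (expmono 1 0 y, expmono 0 1 y) = f y.
  rewrite /g /= e1 e2 !EL//; case: y y1 y2 {e1 e2} => y1 y2 /= y10 y20.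
  (* By [EL], [g] sees the point with coordinates cut at [N]. If a coordinate of [y] exceeds [N],
     the cut one equals [N], and [f] vanishes at both points. *)
  have [yN1|yN1] := leP y1 N; have [yN2|yN2] := leP y2 N => //.
  - by rewrite !f0//=; by [right|left|right; exact: ltW|left; exact: ltW|split].
  - by rewrite !f0//=; by [right|left|right; exact: ltW|left; exact: ltW|split].
  - by rewrite !f0//=; by [right|left|right; exact: ltW|left; exact: ltW|split].
by rewrite -fg; apply: Hn; rewrite ?e1 ?e2; exact: E01.
Qed.

End ExponentialPolynomials.

(** * Bounded continuous functions on the quadrant *)

Section BoundedContinuous.
Variable R : realType.
Implicit Types (f g : R * R -> R) (c : R).

(** An open subset of the plane is a countable union of products of balls with rational centres and
    radii [1 / (n + 1)], and such products are measurable. *)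
Lemma continuous_measurable2 f : continuous f -> measurable_fun setT f.
Proof.
move=> /continuousP cf.
apply: (measurability _ (RGenOpens.measurableE R)) => _ [_ [a [b ->]] <-].
rewrite setTI.
have oO : open (f @^-1` `]a, b[) by apply: cf; exact: interval_open.
set O := f @^-1` _ in oO *.
pose B (i : (rat * rat) * nat) : set (R * R) :=
  ball (ratr i.1.1 : R) (i.2.+1%:R^-1 : R) `*` ball (ratr i.1.2 : R) (i.2.+1%:R^-1 : R).
have -> : O = \bigcup_(i in [set i | B i `<=` O]) B i.
  apply/seteqP; split => [x Ox|x [i iO Bx]]; last exact: iO.
  have /nbhs_ballP[e /= e0 eO] := open_nbhs_nbhs (conj oO Ox).
  have [n ne] : exists n, n.+1%:R^-1 + n.+1%:R^-1 < e.
    exists (Num.truncn (2 / e)).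
    have : 2 / (Num.truncn (2 / e)).+1%:R < e.
      by rewrite ltr_pdivrMr// mulrC -ltr_pdivrMr// Num.Theory.truncnS_gt.
    by set d := _^-1; lra.
  have rd (r : R) : exists q : rat, `|ratr q - r| < n.+1%:R^-1.
    have n0 : 0 < n.+1%:R^-1 :> R by rewrite invr_gt0.
    have rr : r - n.+1%:R^-1 < r + n.+1%:R^-1.
      by move: n0; set d := _^-1; lra.
    have [q /=] := rat_in_itvoo rr.
    by rewrite in_itv/= => H; exists q; rewrite ltr_distl.
  have [q1 Hq1] := rd x.1; have [q2 Hq2] := rd x.2.
  exists ((q1, q2), n) => /=; last by split.
  move=> y [y1 y2]; apply: eO; split => /=; rewrite /ball /=.
    move: y1; rewrite /ball /= => y1.
    rewrite (_ : x.1 - y.1 = (ratr q1 - y.1) - (ratr q1 - x.1)); last by ring.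
    apply: le_lt_trans (ler_normB _ _) _; apply: lt_trans ne; exact: ltrD.
  move: y2; rewrite /ball /= => y2.
  rewrite (_ : x.2 - y.2 = (ratr q2 - y.2) - (ratr q2 - x.2)); last by ring.
  apply: le_lt_trans (ler_normB _ _) _; apply: lt_trans ne; exact: ltrD.
rewrite bigcup_mkcond; apply: countable_bigcupT_measurable => //.
move=> i; case: ifPn => // _.
by apply: measurableX; exact: measurable_ball.
Qed.

(** Boundedness is asked on the quadrant only, since exponentials [expR (- dotp y l)] are in general
    unbounded elsewhere. *)
Definition bcont f :=
  continuous f /\ exists M, forall x, orthant x -> `|f x| <= M.

Lemma bcont_cst c : bcont (fun=> c).
Proof. by split; [move=> x; exact: cvg_cst|exists `|c|]. Qed.

Lemma bcontD f g : bcont f -> bcont g -> bcont (fun x => f x + g x).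
Proof.
move=> [cf [M Mf]] [cg [N Ng]]; split; first by move=> x; exact: (cvgD (cf x) (cg x)).
exists (M + N) => x Dx; apply: le_trans (ler_normD _ _) _.
by apply: lerD; [exact: Mf|exact: Ng].
Qed.

Lemma bcontM f g : bcont f -> bcont g -> bcont (fun x => f x * g x).
Proof.
move=> [cf [M Mf]] [cg [N Ng]]; split; first by move=> x; exact: (cvgM (cf x) (cg x)).
exists (M * N) => x Dx; rewrite normrM.
by apply: ler_pM => //; [exact: Mf|exact: Ng].
Qed.

Lemma bcontZ c f : bcont f -> bcont (fun x => c * f x).
Proof. by apply: bcontM; exact: bcont_cst. Qed.

Lemma bcontB f g : bcont f -> bcont g -> bcont (fun x => f x - g x).
Proof.
move=> bf /(bcontZ (-1)) bg.
rewrite (_ : (fun x => _) = (fun x => f x + -1 * g x)); first exact: bcontD.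
by apply/funext => x; rewrite mulN1r.
Qed.

Lemma bcont_sum (f : nat -> R * R -> R) n :
  (forall i, bcont (f i)) -> bcont (fun x => \sum_(i < n) f i x).
Proof.
move=> bf; elim: n => [|n IH].
  by under eq_fun do rewrite big_ord0; exact: bcont_cst.
by under eq_fun do rewrite big_ord_recr /=; exact: bcontD.
Qed.

Definition clamp (r : R) := Num.max 0 (Num.min 1 r).

Lemma clamp_ge0 r : 0 <= clamp r. Proof. by rewrite /clamp le_max lexx. Qed.

Lemma clamp_le1 r : clamp r <= 1.
Proof. by rewrite /clamp ge_max ler01 ge_min lexx. Qed.

Lemma clamp_le0 r : r <= 0 -> clamp r = 0.
Proof. by move=> r0; rewrite /clamp max_l// ge_min r0 orbT. Qed.

Lemma clamp_ge1 r : 1 <= r -> clamp r = 1.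
Proof. by move=> r0; rewrite /clamp min_l// max_r. Qed.

Lemma le_clamp r r' : r <= r' -> clamp r <= clamp r'.
Proof.
move=> rr'; have [r0|r0] := leP r 0; first by rewrite clamp_le0// clamp_ge0.
have [r1|r1] := leP 1 r'; first by rewrite (clamp_ge1 r1) clamp_le1.
by rewrite /clamp !min_r ?max_r//; lra.
Qed.

Lemma bcont_clamp f : continuous f -> bcont (fun x => clamp (f x)).
Proof.
move=> cf; split.
  move=> x; apply: (@continuous_max _ _ (fun=> 0) (fun x => Num.min 1 (f x))).
    exact: cvg_cst.
  by apply: (@continuous_min _ _ (fun=> 1) f); [exact: cvg_cst|exact: cf].
by exists 1 => x _; rewrite ger0_norm ?clamp_ge0// clamp_le1.
Qed.

(** A layer decomposition: the summand [i] is the length of the part of [[0, r]] lying in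
    [[i, i + 1]]. *)
Lemma sum_clamp n (r : R) : 0 <= r <= n%:R -> \sum_(i < n) clamp (r - i%:R) = r.
Proof.
suff H : 0 <= r -> \sum_(i < n) clamp (r - i%:R) = Num.min r n%:R.
  by move=> /andP[/H -> rn]; rewrite min_l.
move=> r0; elim: n => [|n IH]; first by rewrite big_ord0 min_r.
rewrite big_ord_recr /= IH -natr1.
have [rn|nr] := leP r n%:R.
  by rewrite clamp_le0 ?subr_le0// addr0 min_l//; lra.
have [rn|{}nr] := leP r (n%:R + 1); last by rewrite clamp_ge1//; lra.
by rewrite /clamp min_r ?max_r; lra.
Qed.

Lemma continuous_expdot l : continuous (fun y : R * R => expR (- dotp y l)).
Proof.
move=> x; apply: (@continuous_comp _ _ _ (fun y => - dotp y l) (@expR R));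
  last exact: continuous_expR.
apply: cvgN; rewrite /dotp /=; apply: cvgD.
  by apply: cvgM; [exact: cvg_fst|exact: cvg_cst].
by apply: cvgM; [exact: cvg_snd|exact: cvg_cst].
Qed.

Lemma dotp_ge0 (y l : R * R) : orthant y -> orthant l -> 0 <= dotp y l.
Proof. by move=> [y1 y2] [l1 l2]; rewrite addr_ge0// mulr_ge0. Qed.

Lemma bcont_expdot l : orthant l -> bcont (fun y : R * R => expR (- dotp y l)).
Proof.
move=> Dl; split; first exact: continuous_expdot.
exists 1 => y Dy; rewrite ger0_norm ?expR_ge0// -expR0 ler_expR oppr_le0.
exact: dotp_ge0.
Qed.

Lemma bcont_expoly P : expoly P -> bcont P.
Proof.
elim=> [c j k|P1 P2 _ b1 _ b2]; last exact: bcontD.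
by apply: bcontZ; apply: bcont_expdot; split => /=.
Qed.

Lemma measurable_orthant : measurable (@orthant R).
Proof.
rewrite (_ : @orthant R = `[0, +oo[ `*` `[0, +oo[); first exact: measurableX.
by apply/seteqP; split => x /=; rewrite /orthant /= !in_itv /= !andbT.
Qed.

End BoundedContinuous.

(** * Riesz representation *)

Section PositiveFunctional.
Variable R : realType.
Implicit Types (f g : R * R -> R) (c : R).
Local Notation D := (@orthant R).

(** Nothing is asked outside [bcont], so that a limit of integrals qualifies even though it may fail
    to exist for other functions. *)
Definition posfun (L : (R * R -> R) -> R) : Prop :=
  [/\ L (fun=> 1) = 1,
      forall c f g, bcont f -> bcont g ->
        L (fun x => c * f x + g x) = c * L f + L g &
      forall f g, bcont f -> bcont g -> (forall x, D x -> f x <= g x) ->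
        L f <= L g].

Section Theory.
Variable L : (R * R -> R) -> R.
Context (posL : posfun L).

Lemma posfun_le f g : bcont f -> bcont g -> (forall x, D x -> f x <= g x) ->
  L f <= L g.
Proof. by case: posL => _ _; apply. Qed.

Lemma posfun_eq f g : bcont f -> bcont g -> (forall x, D x -> f x = g x) ->
  L f = L g.
Proof.
by move=> bf bg fg; apply/eqP; rewrite eq_le !posfun_le// => x /fg ->.
Qed.

Lemma posfunD f g : bcont f -> bcont g -> L (fun x => f x + g x) = L f + L g.
Proof.
case: posL => _ H _ bf bg; rewrite -[L f]mul1r -H//.
by congr L; apply/funext => x; rewrite mul1r.
Qed.

Lemma posfun0 : L (fun=> 0) = 0.
Proof.
have := posfunD (bcont_cst 0) (bcont_cst 0); rewrite (_ : (fun=> 0 + 0) = fun=> 0).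
  lra.
by apply/funext => x; rewrite addr0.
Qed.

Lemma posfunZ c f : bcont f -> L (fun x => c * f x) = c * L f.
Proof.
case: posL => _ H _ bf; have := H c f _ bf (bcont_cst 0); rewrite posfun0 addr0 => <-.
by congr L; apply/funext => x; rewrite addr0.
Qed.

Lemma posfun_cst c : L (fun=> c) = c.
Proof.
have := posfunZ c (bcont_cst 1); case: posL => -> _ _; rewrite mulr1 => {2}<-.
by congr L; apply/funext => x; rewrite mulr1.
Qed.

Lemma posfunB f g : bcont f -> bcont g -> L (fun x => f x - g x) = L f - L g.
Proof.
move=> bf bg; rewrite -mulN1r -posfunZ// -posfunD//; last exact: bcontZ.
by congr L; apply/funext => x; rewrite mulN1r.
Qed.

Lemma posfun_ge0 f : bcont f -> (forall x, D x -> 0 <= f x) -> 0 <= L f.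
Proof. by move=> bf f0; rewrite -posfun0; apply: posfun_le => //; exact: bcont_cst. Qed.

Lemma posfun_sum (f : nat -> R * R -> R) n : (forall i, bcont (f i)) ->
  L (fun x => \sum_(i < n) f i x) = \sum_(i < n) L (f i).
Proof.
move=> bf; elim: n => [|n IH].
  by under eq_fun do rewrite big_ord0; rewrite big_ord0 posfun0.
under eq_fun do rewrite big_ord_recr /=.
by rewrite big_ord_recr /= posfunD// ?IH//; exact: bcont_sum.
Qed.

End Theory.

Section Integral.
Variable mu : {measure set (R * R)%type -> \bar R}.
Context (mu1 : mu D = 1%E).

Lemma integrable_bcont f : bcont f -> mu.-integrable D (EFin \o f).
Proof.
move=> [cf [M fM]]; apply: measurable_bounded_integrable.
- exact: measurable_orthant.
- by rewrite mu1 ltry.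
- by apply: measurable_funTS; exact: continuous_measurable2.
- exists M; split; first exact: num_real.
  by move=> N /= MN x Dx; apply: le_trans (fM x Dx) (ltW MN).
Qed.

Lemma posfun_Rintegral : posfun (fun f => \int[mu]_(x in D) f x).
Proof.
have mD := @measurable_orthant R.
split.
- by rewrite Rintegral_cst// mul1r [mu _]mu1.
- move=> c f g bf bg; rewrite RintegralD//; try exact: integrable_bcont.
    by rewrite RintegralZl//; exact: integrable_bcont.
  exact: (integrable_bcont (bcontZ c bf)).
- by move=> f g bf bg fg; apply: le_Rintegral => //; exact: integrable_bcont.
Qed.

Lemma EFin_Rintegral_bcont f : bcont f ->
  (\int[mu]_(x in D) f x)%:E = (\int[mu]_(x in D) (f x)%:E)%E.
Proof.
move=> bf; rewrite /Rintegral fineK//; apply: integrable_fin_num => //.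
  exact: measurable_orthant.
exact: integrable_bcont.
Qed.

End Integral.

(* Tightness, expressed by means of cut-off functions. *)
Definition tight (L : (R * R -> R) -> R) := forall e, 0 < e ->
  exists (K : set (R * R)) (chi : R * R -> R), [/\ compact K, K `<=` D, bcont chi &
    [/\ forall x, D x -> 0 <= chi x <= 1, forall x, D x -> ~ K x -> chi x = 0 &
    1 - e <= L chi]].

End PositiveFunctional.

(** * The outer measure of a positive functional *)

Section Representation.
Variables (R : realType) (L : (R * R -> R) -> R).
Context (posL : posfun L).
Implicit Types (E : set (R * R)) (f g : R * R -> R) (s : R).
Local Notation D := (@orthant R).

(** Increasing sequences take the place of single functions so that countably many covers merge into
    one; [s] bounds the limit of [L (f n)]. Points outside the quadrant need not be covered. *)
Definition covering E s : Prop := exists f : nat -> R * R -> R,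
  [/\ forall n, bcont (f n),
      forall n x, D x -> 0 <= f n x,
      forall m n x, D x -> (m <= n)%N -> f m x <= f n x,
      forall x, E x -> D x -> exists n, 1 <= f n x &
      forall n, L (f n) <= s].

Lemma covering_ge0 E s : covering E s -> 0 <= s.
Proof.
by move=> [f [bf f0 _ _ Lf]]; apply: le_trans (Lf 0%N); apply: posfun_ge0 => //;
  exact: f0.
Qed.

Lemma covering_cst E f s : bcont f -> (forall x, D x -> 0 <= f x) ->
  (forall x, E x -> D x -> 1 <= f x) -> L f <= s -> covering E s.
Proof. by move=> bf f0 f1 fs; exists (fun=> f); split=> // x Ex Dx; exists 0%N;
  exact: f1. Qed.

Definition outer E : \bar R := ereal_inf (EFin @` covering E).

Lemma outer_ge0 E : (0 <= outer E)%E.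
Proof.
by apply/ereal_infP => _ [s cs <-]; rewrite lee_fin; exact: covering_ge0 cs.
Qed.

Lemma outer_le E s : covering E s -> (outer E <= s%:E)%E.
Proof. by move=> cs; apply: ereal_inf_lbound; exists s. Qed.

Lemma outer_offD E : (forall x, E x -> ~ D x) -> outer E = 0%E.
Proof.
move=> ED; apply/eqP; rewrite eq_le outer_ge0 andbT; apply: outer_le.
apply: (covering_cst (bcont_cst 0)) => //; first by move=> x /ED.
by rewrite posfun0.
Qed.

Lemma outer_le1 E : (outer E <= 1)%E.
Proof.
apply: outer_le; apply: (covering_cst (bcont_cst 1)) => //.
by rewrite posfun_cst.
Qed.

Lemma le_outer : {homo outer : A B / A `<=` B >-> (A <= B)%E}.
Proof.
move=> A B AB; apply/ereal_infP => _ [s [f [? ? ? fB ?]] <-]; apply: outer_le.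
by exists f; split=> // x /AB; exact: fB.
Qed.

Lemma outer_approx E e : 0 < e ->
  exists s, covering E s /\ (s%:E <= outer E + e%:E)%E.
Proof.
move=> e0.
have fin : outer E \is a fin_num.
  rewrite ge0_fin_numE ?outer_ge0//; apply: le_lt_trans (outer_le1 _) _.
  exact: ltry.
have [_ [s cs <-] /ltW H] := lb_ereal_inf_adherent e0 fin.
by exists s.
Qed.

(** Covers of [F n] within [e / 2 ^ n.+1] of optimal are merged diagonally: stage [n] sums the
    members of index [n] of the first [n] covers. *)
Lemma outer_sigma_subadditive : sigma_subadditive outer.
Proof.
move=> F; apply/lee_addgt0Pr => e e0.
have [->|fin] := eqVneq (\sum_(n <oo) outer (F n))%E +oo%E; first
  by rewrite addye// leey.
have S0 : (0 <= \sum_(n <oo) outer (F n))%E.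
  by apply: nneseries_ge0 => n _ _; exact: outer_ge0.
apply: (@le_trans _ _ (fine (\sum_(n <oo) outer (F n)) + e)%:E); last first.
  by rewrite EFinD fineK// ge0_fin_numE// ltey.
have e2 n : 0 < e / (2 ^ n.+1)%:R by rewrite divr_gt0// ltr0n expn_gt0.
have /choice[s Hs] := fun n => outer_approx (F n) (e2 n).
have /choice[f Hf] := fun n => (Hs n).1.
apply: outer_le; exists (fun n x => \sum_(m < n) f m n x); split.
- by move=> n; apply: (@bcont_sum _ (fun m => f m n)) => m; case: (Hf m).
- by move=> n x Dx; apply: sumr_ge0 => m _; case: (Hf m) => _ H _ _ _; exact: H.
- move=> m n x Dx mn.
  rewrite -!(big_mkord xpredT (fun i => f i _ x)) [leRHS](big_cat_nat (leq0n m) mn)//=.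
  apply: (@le_trans _ _ (\sum_(0 <= i < m) f i n x)).
    by apply: ler_sum => i _; case: (Hf i) => _ _ H _ _; exact: H.
  by rewrite lerDl; apply: sumr_ge0 => i _; case: (Hf i) => _ H _ _ _; exact: H.
- move=> x [k _ Fkx] Dx; have [_ f0 fnd fc _] := Hf k.
  have [n n1] := fc x Fkx Dx.
  (* The index must be large enough for [f k] to have reached 1 and for the sum to contain the term
     [k]. *)
  exists (maxn n k.+1); apply: le_trans n1 _.
  apply: (@le_trans _ _ (f k (maxn n k.+1) x)).
    by apply: fnd => //; exact: leq_maxl.
  have kn : (k < maxn n k.+1)%N by rewrite leq_maxr.
  rewrite (bigD1 (Ordinal kn))//= lerDl; apply: sumr_ge0 => i _.
  by case: (Hf i) => _ H _ _ _; exact: H.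
- move=> n; rewrite (@posfun_sum _ _ posL (fun m => f m n)); last first.
    by move=> m; case: (Hf m).
  rewrite -lee_fin EFinD fineK ?ge0_fin_numE ?ltey//.
  apply: le_trans (epsilon_trick xpredT (fun n => outer_ge0 (F n)) (ltW e0)).
  apply: (@le_trans _ _ (\sum_(i < n) (s i)%:E)%E).
    rewrite sumEFin lee_fin; apply: ler_sum => i _.
    by case: (Hf i) => _ _ _ _; exact.
  rewrite -(big_mkord xpredT (fun i => (s i)%:E)).
  apply: (@le_trans _ _ (\sum_(0 <= i < n) (outer (F i) + (e / (2 ^ i.+1)%:R)%:E))%E).
    by apply: lee_sum => i _; exact: (Hs i).2.
  apply: nneseries_lim_ge => i _.
  by rewrite adde_ge0 ?outer_ge0// lee_fin ltW.
Qed.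

HB.instance Definition _ := isOuterMeasure.Build R (R * R)%type outer
  (outer_offD (fun x H => False_ind _ H)) outer_ge0 le_outer outer_sigma_subadditive.

(* The indicator of [0 < p] is the increasing limit of [h_n = clamp (n p)];
   covering functions [f_n] of [E] split into [f_n h_n] and [f_n (1 - h_m)],
   which cover [E] inside and outside [0 < p] respectively. *)
Lemma outer_caratheodory (p : R * R -> R) : continuous p ->
  outer.-caratheodory [set x | 0 < p x].
Proof.
move=> cp; apply: le_caratheodory_measurable => E.
pose h n x := clamp (n%:R * p x).
have bh n : bcont (h n).
  by apply: bcont_clamp => x; apply: cvgM; [exact: cvg_cst|exact: cp].
have h01 n x : 0 <= h n x <= 1 by rewrite clamp_ge0 clamp_le1.
have hnd m n x : (m <= n)%N -> h m x <= h n x.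
  move=> mn; have [p0|p0] := leP (p x) 0.
    by rewrite /h clamp_le0 ?clamp_ge0// mulr_ge0_le0.
  by apply: le_clamp; rewrite ler_pM2r// ler_nat.
apply/ereal_infP => _ [s [f [bf f0 fnd fE fs]] <-].
have cD m : covering (E `&` ~` [set x | 0 < p x]) (s - L (fun x => f m x * h m x)).
  exists (fun n x => f n x * (1 - h m x)); split.
  - by move=> n; apply: bcontM => //; apply: bcontB => //; exact: bcont_cst.
  - by move=> n x Dx; rewrite mulr_ge0 ?f0// subr_ge0; case/andP: (h01 m x).
  - move=> i j x Dx ij; rewrite ler_wpM2r ?fnd// subr_ge0; by case/andP: (h01 m x).
  - move=> x [Ex /= /negP]; rewrite -leNgt => px Dx; have [n n1] := fE x Ex Dx.
    by exists n; rewrite /h clamp_le0 ?subr0 ?mulr1// mulr_ge0_le0.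
  - move=> n; rewrite lerBrDr.
    have b1 k : bcont (fun x => f n x * (1 - h k x)).
      by apply: bcontM => //; apply: bcontB => //; exact: bcont_cst.
    have b2 k : bcont (fun x => f k x * h m x) by exact: bcontM.
    rewrite -posfunD//.
    (* Pointwise, [f n * (1 - h m) + f m * h m] is a convex combination of [f n] and [f m], hence at
       most [f (maxn m n)]. *)
    apply: le_trans (fs (maxn m n)); apply: posfun_le => //; first exact: bcontD.
    move=> x Dx; have /andP[h0 h1] := h01 m x.
    have H1 := fnd _ _ x Dx (leq_maxl m n); have H2 := fnd _ _ x Dx (leq_maxr m n).
    nra.
(* The value in [cD] bounds the outer measure of the outside part for every [m]; taking [m = n]
   bounds [L] of the member of index [n] of the inside cover. *)
have cI : covering (E `&` [set x | 0 < p x])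
  (s - fine (outer (E `&` ~` [set x | 0 < p x]))).
  exists (fun n x => f n x * h n x); split.
  - by move=> n; exact: bcontM.
  - by move=> n x Dx; rewrite mulr_ge0 ?f0//; case/andP: (h01 n x).
  - move=> i j x Dx ij; apply: ler_pM; rewrite ?f0 ?fnd ?hnd//.
    by case/andP: (h01 i x).
  - move=> x [Ex /= px] Dx; have [n n1] := fE x Ex Dx.
    pose k := maxn n (Num.truncn (p x)^-1).+1; exists k.
    rewrite /h clamp_ge1; last first.
      rewrite -ler_pdivrMr// mul1r; apply: ltW.
      apply: lt_le_trans (Num.Theory.truncnS_gt _) _.
      by rewrite ler_nat leq_maxr.
    by rewrite mulr1; apply: le_trans n1 _; apply: fnd => //; exact: leq_maxl.
  - move=> n; rewrite lerBrDl -lerBrDr -lee_fin fineK; first exact: outer_le.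
    rewrite ge0_fin_numE ?outer_ge0//; apply: le_lt_trans (outer_le1 _) _.
    exact: ltry.
apply: le_trans (leeD2r _ (outer_le cI)) _.
rewrite EFinB fineK; last first.
  rewrite ge0_fin_numE ?outer_ge0//; apply: le_lt_trans (outer_le1 _) _.
  exact: ltry.
rewrite subeK//.
rewrite ge0_fin_numE ?outer_ge0//; apply: le_lt_trans (outer_le1 _) _.
exact: ltry.
Qed.

(** The Caratheodory sets form a sigma-algebra, so it suffices that the identity is measurable from
    it coordinate by coordinate. The half-planes [a < x.1] and [a < x.2] have the form [0 < p x]. *)
Lemma outer_measurable E : measurable E -> outer.-caratheodory E.
Proof.
move=> mE.
pose iD : caratheodory_type outer -> R * R := id.
suff H : measurable_fun setT iD by have := H measurableT _ mE; rewrite setTI.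
apply/measurable_fun_pairP; split.
  apply: (measurability _ (RGenOInfty.measurableE R)) => _ [_ [a ->] <-].
  rewrite setTI (_ : _ @^-1` _ = [set x | 0 < x.1 - a]).
    by apply: outer_caratheodory => x; apply: cvgB; [exact: cvg_fst|exact: cvg_cst].
  by apply/seteqP; split => x /=; rewrite in_itv /= andbT subr_gt0.
apply: (measurability _ (RGenOInfty.measurableE R)) => _ [_ [a ->] <-].
rewrite setTI (_ : _ @^-1` _ = [set x | 0 < x.2 - a]).
  by apply: outer_caratheodory => x; apply: cvgB; [exact: cvg_snd|exact: cvg_cst].
by apply/seteqP; split => x /=; rewrite in_itv /= andbT subr_gt0.
Qed.

Lemma outer_semi_sigma_additive :
  semi_sigma_additive (outer : set (R * R)%type -> \bar R).
Proof.
move=> F mF tF mUF.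
exact: (@caratheodory_measure_sigma_additive R (R * R)%type outer F
  (fun n => outer_measurable (mF n)) tF (outer_measurable mUF)).
Qed.

End Representation.

(** * The representing probability measure *)

Section RepresentingMeasure.
Variables (R : realType) (L : (R * R -> R) -> R).
Implicit Types (f g : R * R -> R).
Local Notation D := (@orthant R).

(** A Dini argument: on the compact set [K] some [f n] is at least [1 - e / 2] everywhere, hence
    dominates [(1 - e / 2) * chi] on the quadrant, and [L (f n)] is at least [(1 - e / 2) ^+ 2]. *)
Lemma outer_setT : posfun L -> tight L -> outer L [set: R * R] = 1%E.
Proof.
move=> posL tL; apply/eqP; rewrite eq_le outer_le1//=.
apply/ereal_infP => _ [s [f [bf f0 fnd fc fs]] <-]; rewrite lee_fin.
apply/ler_addgt0Pr => e e0.
have [K [chi [cK KD bchi [chi01 chi0 Lchi]]]] := tL (e / 2) ltac:(lra).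
have : \forall n \near \oo, K `<=` fun x => 1 - e / 2 <= f n x.
  apply: (proj2 (near_covering_withinP K) (proj1 (compact_near_coveringP K) cK)).
  move=> x Kx; have [n n1] := fc x I (KD x Kx).
  have /cvgrPdist_lt /(_ (e / 2) ltac:(lra)) H := (bf n).1 x.
  exists ([set y | `|f n x - f n y| < e / 2], [set m | (n <= m)%N]) => /=.
    by split => //; exact: nbhs_infty_ge.
  move=> [y m] /= [fy nm] Ky.
  have := fnd n m y (KD y Ky) nm.
  by move: fy; rewrite ltr_norml; lra.
move=> /filter_ex [n Kn].
(* The final estimate needs [1 - e / 2] to be nonnegative; for larger [e], [0 <= s] is enough. *)
have [e2|e2] := leP e 2; last
  by have := covering_ge0 posL (ex_intro _ f (And5 bf f0 fnd fc fs)); lra.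
have : (1 - e / 2) * L chi <= L (f n).
  rewrite -posfunZ//; apply: posfun_le => //; first exact: bcontZ.
  move=> x Dx; have /andP[c0 c1] := chi01 x Dx.
  have [Kx|nKx] := pselect (K x).
    by have := Kn x Kx; nra.
  by rewrite chi0// mulr0 f0.
have := fs n; nra.
Qed.

(** The proofs are arguments so that the measure and probability structures below can be inferred
    from the term itself. *)
Definition representing (_ : posfun L) (_ : tight L) : set (R * R)%type -> \bar R :=
  outer L.

Section Instances.
Context (posL : posfun L) (tL : tight L).

Let rep0 : representing posL tL set0 = 0%E.
Proof. by apply: (outer_offD posL) => x. Qed.

Let rep_ge0 A : (0 <= representing posL tL A)%E.
Proof. exact: (outer_ge0 posL). Qed.

Let rep_additive : semi_sigma_additive (representing posL tL).
Proof. exact: (outer_semi_sigma_additive posL). Qed.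

HB.instance Definition _ := isMeasure.Build _ _ _ (representing posL tL)
  rep0 rep_ge0 rep_additive.

Let rep_setT : representing posL tL setT = 1%E.
Proof. exact: outer_setT. Qed.

HB.instance Definition _ := Measure_isProbability.Build _ _ _
  (representing posL tL) rep_setT.

End Instances.

(** For [0 <= f <= 1], a comparison of layers bounds the integral by [L f]. Applying this to [1 - f]
    gives equality, and an affine rescaling reaches every bounded [f]. *)
Theorem riesz_representation : posfun L -> tight L ->
  exists mu : probability (R * R)%type R, mu D = 1%E /\
    forall f, bcont f -> \int[mu]_(x in D) f x = L f.
Proof.
move=> posL tL; pose mu : probability (R * R)%type R := representing posL tL.
have mD := @measurable_orthant R.
have muD : mu D = 1%E.
  have := @probability_setC _ _ _ mu (~` D) (measurableC mD).
  by rewrite setCK => ->; rewrite (_ : mu _ = 0%E) ?sube0//; exact: (outer_offD posL).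
exists mu; split => //.
have posI := posfun_Rintegral muD.
(* With [phi_i = clamp (n f - i)] one has [n f = \sum_(i < n) phi_i] and
   [phi_(i + 1) <= 1_(n f >= i + 1) <= phi_i]. *)
have H01 f : bcont f -> (forall x, D x -> 0 <= f x <= 1) -> \int[mu]_(x in D) f x <=
  L f.
  move=> bf f01; apply/ler_addgt0Pr => e e0.
  pose n := (Num.truncn e^-1).+1.
  have ne : e^-1 < n%:R by exact: Num.Theory.truncnS_gt.
  have n0 : 0 < n%:R :> R by rewrite ltr0n.
  pose phi i x := clamp (n%:R * f x - i%:R).
  have cphi : forall i, continuous (fun x => n%:R * f x - i%:R).
    move=> i x; apply: cvgB; last exact: cvg_cst.
    by apply: cvgM; [exact: cvg_cst|exact: bf.1].
  have bphi i : bcont (phi i) by apply: bcont_clamp; exact: cphi.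
  have sphi (F : (R * R -> R) -> R) : posfun F -> n%:R * F f = \sum_(i < n) F (phi i).
    move=> posF; rewrite -posfunZ// -(@posfun_sum _ _ posF phi)//.
    apply: posfun_eq => //; [exact: bcontZ|exact: bcont_sum|].
    move=> x Dx; rewrite sum_clamp//.
    by have /andP[? ?] := f01 x Dx; rewrite mulr_ge0// ler_piMr// ltW.
  have step i : \int[mu]_(x in D) phi i.+1 x <= L (phi i).
    pose A := [set x | i.+1%:R <= n%:R * f x].
    have mA : measurable A.
      rewrite (_ : A = (fun x => n%:R * f x - i.+1%:R) @^-1` `[0, +oo[); last first.
        by apply/seteqP; split => x /=; rewrite in_itv /= andbT subr_ge0.
      by rewrite -[X in measurable X]setTI; apply: continuous_measurable2.
    rewrite -lee_fin EFin_Rintegral_bcont//.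
    apply: (@le_trans _ _ (mu A)); last first.
      apply: outer_le; apply: (covering_cst (bphi i)) => //.
        by move=> x _; exact: clamp_ge0.
      move=> x Ax _; rewrite /phi clamp_ge1//.
      by move: Ax; rewrite /A /= -natr1; lra.
    apply: (@le_trans _ _ (\int[mu]_(x in D) (\1_A x)%:E)%E).
      apply: ge0_le_integral => //.
      - by move=> x _; rewrite lee_fin clamp_ge0.
      - by apply/measurable_EFinP; apply: measurable_funTS;
          apply: continuous_measurable2; case: (bphi i.+1).
      - by apply/measurable_EFinP; apply: measurable_funTS; exact: measurable_indic.
      - move=> x _; rewrite lee_fin indicE; have [xA|xA] := boolP (x \in A).
          exact: clamp_le1.
        rewrite /phi clamp_le0//; move: xA; rewrite notin_setE /A /= => /negP.
        by rewrite -ltNge => /ltW; rewrite subr_le0.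
    rewrite integral_indic//; apply: le_measure; rewrite ?inE//.
    exact: measurableI.
  (* The shift of index between the two sums costs one layer, whose integral is at most 1; after
     division by [n] this is below [e]. *)
  have nfL : n%:R * \int[mu]_(x in D) f x <= 1 + n%:R * L f.
    rewrite (sphi _ posI) (sphi _ posL) /n big_ord_recl [in leRHS]big_ord_recr /=.
    apply: lerD.
      rewrite -[leRHS](posfun_cst posI 1); apply: (posfun_le posI) => //.
        exact: bcont_cst.
      by move=> x _; exact: clamp_le1.
    apply: (@le_trans _ _ (\sum_(i < Num.truncn e^-1) L (phi i))).
      by apply: ler_sum => i _; exact: step.
    by rewrite lerDl; apply: posfun_ge0 => // x _; exact: clamp_ge0.
  rewrite -(ler_pM2l n0); apply: le_trans nfL _.
  rewrite mulrDr addrC lerD2l -ler_pdivrMr//.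
  by rewrite mul1r ltW.
have E01 f : bcont f -> (forall x, D x -> 0 <= f x <= 1) -> \int[mu]_(x in D) f x = L f.
  move=> bf f01; apply/eqP; rewrite eq_le H01//=.
  have b1 := bcont_cst (1 : R).
  have := H01 (fun x => 1 - f x) (bcontB b1 bf).
  rewrite (posfunB posI)// (posfunB posL)// !posfun_cst// => H.
  suff : 1 - \int[mu]_(x in D) f x <= 1 - L f by lra.
  by apply: H => x /f01; lra.
move=> f bf; have [_ [M fM]] := bf.
pose N := `|M| + 1.
have N0 : 0 < N by rewrite /N ltr_wpDl.
(* On the quadrant [f / N] lies in [[-1, 1]], which this map sends into [[0, 1]]. *)
pose g x := (2 * N)^-1 * f x + 2^-1.
have bg : bcont g by apply: bcontD; [exact: bcontZ|exact: bcont_cst].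
have g01 x : D x -> 0 <= g x <= 1.
  move=> /fM; rewrite ler_norml => /andP[f1 f2].
  have MN : M <= N by rewrite /N; have := ler_norm M; lra.
  have : -1 <= f x / N <= 1.
    by rewrite ler_pdivrMr// ler_pdivlMr//; apply/andP; split; lra.
  rewrite /g invfM mulrAC -mulrA (mulrC (f x)); lra.
have Hg := E01 g bg g01.
rewrite /g in Hg.
move: Hg; rewrite (posfunD posI) ?(posfunD posL)//; try exact: bcontZ;
  try exact: bcont_cst.
rewrite !posfun_cst// !posfunZ// => /addIr /mulfI; apply.
by rewrite invr_eq0 mulf_neq0// gt_eqF.
Qed.

End RepresentingMeasure.

(** * Laplace transforms *)

Section LaplaceTransform.
Variable R : realType.
Implicit Types (f g : R * R -> R) (l : R * R).
Local Notation D := (@orthant R).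

Lemma eq_outer (L L' : (R * R -> R) -> R) E :
  (forall f, bcont f -> L f = L' f) -> outer L E = outer L' E.
Proof.
move=> LL'; congr (ereal_inf (_ @` _)); apply/seteqP.
by split => s [f [bf f0 fnd fE fs]]; exists f; split=> // n; [rewrite -LL'|rewrite LL'].
Qed.

Lemma measurable_bcont_ge f c : bcont f -> measurable [set x | c <= f x].
Proof.
move=> [cf _]; rewrite (_ : [set _ | _] = f @^-1` `[c, +oo[).
  by rewrite -[X in measurable X]setTI; apply: continuous_measurable2.
by apply/seteqP; split => x /=; rewrite in_itv /= andbT.
Qed.

(** For a cover [f], the sets where [f n] is at least 1 increase to a superset of [A] within the
    quadrant. Each has measure at most [s] by Markov's inequality; continuity from below
    concludes. *)
Lemma probability_le_outer (mu : probability (R * R)%type R) A :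
  mu D = 1%E -> measurable A ->
  (mu A <= outer (fun f => (\int[mu]_(x in D) f x)%R) A)%E.
Proof.
move=> muD mA; apply/ereal_infP => _ [s [f [bf f0 fnd fA fs]] <-].
have mD := @measurable_orthant R.
pose F n := D `&` [set x | 1 <= f n x].
have mF n : measurable (F n) by apply: measurableI => //; exact: measurable_bcont_ge.
have mUF : measurable (\bigcup_n F n) by exact: bigcupT_measurable.
have muF n : (mu (F n) <= s%:E)%E.
  apply: (@le_trans _ _ (\int[mu]_(x in D) f n x)%R%:E); last by rewrite lee_fin.
  rewrite EFin_Rintegral_bcont// /F setIC -integral_indic//;
    last exact: measurable_bcont_ge.
  apply: ge0_le_integral => //.
  - apply/measurable_EFinP; apply: measurable_funTS; apply: measurable_indic.
    exact: measurable_bcont_ge.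
  - by apply/measurable_EFinP; apply: measurable_funTS; apply: continuous_measurable2;
      case: (bf n).
  - move=> x Dx; rewrite lee_fin indicE; case: (boolP (x \in _)) => /=;
      last by rewrite f0.
    by rewrite inE.
apply: (@le_trans _ _ (mu ((\bigcup_n F n) `|` ~` D))).
  apply: le_measure; rewrite ?inE//; first by apply: measurableU => //;
    exact: measurableC.
  move=> x Ax; have [Dx|nDx] := pselect (D x); last by right.
  by have [n fn] := fA x Ax Dx; left; exists n.
apply: (le_trans (measureU2 _ _ _)) => //; first exact: measurableC.
have D0 : mu (~` D) = 0%E by rewrite probability_setC// [X in (1 - X)%E]muD subee.
rewrite -[leRHS]adde0; apply: leeD; last by rewrite [leLHS]D0.
have ndF : {homo F : n m / (n <= m)%N >-> (n <= m)%O}.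
  move=> m n mn; apply/subsetPset => x [Dx fx]; split => //.
  exact: le_trans fx (fnd _ _ _ Dx mn).
have cF := nondecreasing_cvg_mu (mu := mu) mF mUF ndF.
have : (lim ((mu \o F) n @[n --> \oo]) <= s%:E)%E.
  apply: lime_le; first by apply/cvg_ex; eexists; exact: cF.
  by apply: nearW => n; exact: muF.
by rewrite (cvg_lim (@ereal_hausdorff R) cF).
Qed.

(** By tightness the outer measure is itself a probability on Borel sets, so the previous
    inequality, applied to the complement of [A], gives the reverse one. *)
Lemma probability_outer (mu : probability (R * R)%type R) A :
  mu D = 1%E -> tight (fun f => \int[mu]_(x in D) f x) -> measurable A ->
  mu A = outer (fun f => \int[mu]_(x in D) f x) A.
Proof.
move=> muD tmu mA; apply/eqP; rewrite eq_le probability_le_outer//=.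
pose P : probability (R * R)%type R := representing (posfun_Rintegral muD) tmu.
have : (mu (~` A) <= P (~` A))%E by apply: probability_le_outer => //;
  exact: measurableC.
rewrite !probability_setC//.
have fm : mu A \is a fin_num by exact: fin_num_measure.
have fP : P A \is a fin_num by exact: fin_num_measure.
rewrite -[outer _ _]/(P A) -(fineK fm) -(fineK fP) -!EFinB !lee_fin.
by rewrite lerD2l lerN2.
Qed.

Section Cutoff.
Variable d : R.
Context (d_gt0 : 0 < d).

(** Built from an exponential so that the mass it removes is controlled by the Laplace transform at
    [(d, d)]. *)
Definition cutoff (y : R * R) := clamp (2 * expR (- dotp y (d, d)) - 1).

Lemma bcont_cutoff : bcont cutoff.
Proof.
apply: bcont_clamp => x; apply: cvgB; last exact: cvg_cst.
by apply: cvgM; [exact: cvg_cst|exact: continuous_expdot].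
Qed.

(** In this region [dotp y (d, d)] is at least 1, and [expR r >= 1 + r] makes the exponential at
    most [1 / 2]. *)
Lemma cutoff_eq0 y : D y -> d^-1 <= y.1 \/ d^-1 <= y.2 -> cutoff y = 0.
Proof.
move=> [y1 y2] H; rewrite /cutoff clamp_le0// subr_le0.
have H1 : 1 <= dotp y (d, d).
  rewrite /dotp /= -mulrDl -ler_pdivrMr// mul1r.
  by case: H; lra.
rewrite expRN -ler_pdivlMr ?invr_gt0 ?expR_gt0// invrK mul1r.
by apply: le_trans (expR_ge1Dx _); lra.
Qed.

Lemma cutoff_ge y : D y -> 1 - cutoff y <= 2 * (1 - expR (- dotp y (d, d))).
Proof.
move=> Dy; have e1 : expR (- dotp y (d, d)) <= 1.
  by rewrite -expR0 ler_expR oppr_le0; apply: dotp_ge0 => //; split => /=; exact: ltW.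
rewrite /cutoff; set e := expR _ in e1 *.
have [r0|r0] := leP (2 * e - 1) 0; first by rewrite clamp_le0//; lra.
by rewrite /clamp min_r ?max_r; lra.
Qed.

End Cutoff.

(** The functions [cutoff d] vanish on the quadrant outside the square of side [1 / d], and by
    [cutoff_ge] they lose at most twice the defect of the Laplace transform at [(d, d)]; hence the
    use of [e / 2]. *)
Lemma tight_laplace (L : (R * R -> R) -> R) : posfun L ->
  (forall e, 0 < e ->
     exists2 d, 0 < d & 1 - e <= L (fun y => expR (- dotp y (d, d)))) ->
  tight L.
Proof.
move=> posL H e e0; have [d d0 Hd] := H (e / 2) ltac:(lra).
exists (`[0, d^-1] `*` `[0, d^-1]), (cutoff d); split.
- by apply: compact_setX; exact: segment_compact.
- by move=> y [] /=; rewrite !in_itv /= => /andP[? _] /andP[? _].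
- exact: bcont_cutoff.
split.
- by move=> x _; rewrite clamp_ge0 clamp_le1.
- move=> x [x1 x2] nK; apply: cutoff_eq0 => //;
    apply: contrapT => /not_orP[/negP + /negP].
  rewrite -!ltNge => /ltW h1 /ltW h2; apply: nK.
  by split => /=; rewrite in_itv /= ?x1 ?x2.
have be : bcont (fun y => expR (- dotp y (d, d))).
  by apply: bcont_expdot; split => /=; exact: ltW.
have b1 := bcont_cst (1 : R).
have : L (fun y => 1 - cutoff d y) <= L (fun y => 2 * (1 - expR (- dotp y (d, d)))).
  apply: posfun_le => //;
    [by apply: bcontB => //; exact: bcont_cutoff| |exact: cutoff_ge].
  by apply: bcontZ; exact: bcontB.
rewrite posfunZ//; last exact: bcontB.
rewrite !posfunB//; last exact: bcont_cutoff.
by rewrite posfun_cst//; lra.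
Qed.

Lemma expoly_approx f e d : bcont f -> 0 < d -> 0 < e ->
  exists P, expoly P /\ forall y, D y -> `|P y - f y * cutoff d y| <= e.
Proof.
move=> bf d0 e0; have [cf [M fM]] := bcontM bf (bcont_cutoff d).
apply: (@expoly_dense _ _ M d^-1) => //; last by rewrite invr_ge0 ltW.
by move=> y Dy H; rewrite cutoff_eq0// mulr0.
Qed.

(* Cut off, then approximate by exponential polynomials. *)
Lemma posfun_approx f : bcont f -> exists2 M, 0 < M &
  forall d e, 0 < d -> 0 < e -> exists P, expoly P /\
    forall L : (R * R -> R) -> R, posfun L ->
      `|L P - L f| <= e + M * (1 - L (fun y => expR (- dotp y (d, d)))).
Proof.
move=> bf; have [_ [M0 fM0]] := bf.
pose M := `|M0| + 1.
have M1 : 0 < M by rewrite /M ltr_wpDl.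
have fM x : D x -> `|f x| <= M.
  by move=> /fM0 /le_trans; apply; rewrite /M; have := ler_norm M0; lra.
(* The factor 2 is that of [cutoff_ge]. The polynomial [P] is fixed before [L], so that one choice
   serves a whole family of functionals. *)
exists (M * 2) => [|d e d0 e0]; first by rewrite mulr_gt0.
have [P [eP HP]] := expoly_approx bf d0 e0; exists P; split=> // L posL.
have bP := bcont_expoly eP; have b1 := bcont_cst (1 : R).
have be : bcont (fun y => expR (- dotp y (d, d))).
  by apply: bcont_expdot; split => /=; exact: ltW.
have bg : bcont (fun x => e + M * 2 * (1 - expR (- dotp x (d, d)))).
  by apply: bcontD; [exact: bcont_cst|apply: bcontZ; exact: bcontB].
have -> : e + M * 2 * (1 - L (fun y => expR (- dotp y (d, d)))) =
    L (fun x => e + M * 2 * (1 - expR (- dotp x (d, d)))).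
  rewrite posfunD//; [|exact: bcont_cst|by apply: bcontZ; exact: bcontB].
  by rewrite posfunZ ?posfunB ?posfun_cst//; exact: bcontB.
have H x : D x -> `|P x - f x| <= e + M * 2 * (1 - expR (- dotp x (d, d))).
  move=> Dx;
    rewrite (_ : P x - f x = (P x - f x * cutoff d x) - f x * (1 - cutoff d x));
      last by ring.
  apply: le_trans (ler_normB _ _) _; apply: lerD; first exact: HP.
  rewrite normrM -mulrA; apply: ler_pM => //; first exact: fM.
  rewrite ger0_norm; first exact: cutoff_ge.
  by rewrite subr_ge0 clamp_le1.
rewrite -posfunB// ler_norml -[- L _]mulN1r -posfunZ//; apply/andP; split.
  apply: posfun_le => //; [exact: bcontZ|exact: bcontB|].
  by move=> x /H; rewrite ler_norml mulN1r => /andP[].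
by apply: posfun_le => //; [exact: bcontB|move=> x /H; rewrite ler_norml => /andP[]].
Qed.

(** Linearity gives convergence on exponential polynomials. The error of approximating [f] by one of
    them is uniform over large [t], so [F t f] is Cauchy. *)
Lemma laplace_cvg_bcont (F : R -> (R * R -> R) -> R) (lam : R * R -> R) f :
  (forall t, 0 <= t -> posfun (F t)) ->
  (forall l, D l -> F t (fun y => expR (- dotp y l)) @[t --> +oo] --> lam l) ->
  (forall e, 0 < e -> exists2 d, 0 < d & 1 - e <= lam (d, d)) ->
  bcont f -> cvg (F t f @[t --> +oo]).
Proof.
move=> posF Flam lam0 bf.
have cP P : expoly P -> cvg (F t P @[t --> +oo]).
  elim=> [c j k|P1 P2 eP1 c1 eP2 c2].
    have bjk : bcont (@expmono R j k) by apply: bcont_expdot; split => /=.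
    apply/cvg_ex; exists (c * lam (j%:R, k%:R)).
    apply: cvg_trans (cvgM (cvg_cst c) (Flam (j%:R, k%:R) _)); last by split => /=.
    apply: near_eq_cvg; near=> t.
    have t0 : 0 <= t by near: t; exact: nbhs_pinfty_ge.
    by rewrite (posfunZ (posF t t0)).
  apply/cvg_ex; exists (lim (F t P1 @[t --> +oo]) + lim (F t P2 @[t --> +oo])).
  apply: cvg_trans (cvgD c1 c2); apply: near_eq_cvg; near=> t.
  have t0 : 0 <= t by near: t; exact: nbhs_pinfty_ge.
  by rewrite (posfunD (posF t t0))//; exact: bcont_expoly.
apply/cauchy_cvgP/cauchy_exP => e /= e0.
have [M M0 HM] := posfun_approx bf.
(* The error splits into [e / 4] for the limit of [F t P], [e / 4] for the approximation, and
   [e / 2] for the cut-off, since eventually [F t] loses less than [2 * (e / 4 / M)] at [(d, d)]. *)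
have eM : 0 < e / 4 / M by rewrite !divr_gt0.
have [d d0 Hd] := lam0 _ eM.
have [P [eP HP]] := HM d (e / 4) d0 ltac:(lra).
exists (lim (F t P @[t --> +oo])).
have Dd : D (d, d) by split => /=; exact: ltW.
have H1 := cvgr_gt _ (Flam _ Dd) (1 - 2 * (e / 4 / M)) ltac:(lra).
have /cvgrPdist_lt /(_ (e / 4) ltac:(lra)) H2 := cP P eP.
near=> t; rewrite /ball /=.
have t0 : 0 <= t by near: t; exact: nbhs_pinfty_ge.
have Ht1 : 1 - 2 * (e / 4 / M) < F t (fun y => expR (- dotp y (d, d))) by near: t.
have Ht2 : `|lim (F t P @[t --> +oo]) - F t P| < e / 4 by near: t.
have H3 : M * (1 - F t (fun y => expR (- dotp y (d, d)))) < e / 2.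
  have -> : e / 2 = M * (2 * (e / 4 / M)) by field; rewrite gt_eqF.
  by rewrite ltr_pM2l//; lra.
have := HP _ (posF t t0).
move: Ht2; rewrite !ltr_norml !ler_norml; lra.
Unshelve. all: by end_near. Qed.

(** The limit functional inherits positivity and normalisation. Continuity of [lam] at 0 along the
    diagonal makes it tight, so the Riesz representation applies. *)
Theorem laplace_continuity (nu : R -> {measure set (R * R)%type -> \bar R})
    (lam : R * R -> R) :
  (forall t, 0 <= t -> nu t D = 1%E) ->
  (forall l, D l ->
     \int[nu t]_(y in D) expR (- dotp y l) @[t --> +oo] --> lam l) ->
  (forall e, 0 < e -> exists2 d, 0 < d & 1 - e <= lam (d, d)) ->
  exists mu : probability (R * R)%type R, mu D = 1%E /\
    forall f, bcont f ->
      \int[nu t]_(y in D) f y @[t --> +oo] --> \int[mu]_(y in D) f y.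
Proof.
move=> nuD nulam lam0.
pose F t f := \int[nu t]_(y in D) f y.
have posF t : 0 <= t -> posfun (F t) by move=> t0; apply: posfun_Rintegral; exact: nuD.
have cF f : bcont f -> cvg (F t f @[t --> +oo])
  by exact: laplace_cvg_bcont posF nulam lam0.
pose L f := lim (F t f @[t --> +oo]).
have posL : posfun L.
  split.
  - apply: cvg_lim => //; apply: cvg_near_cst; near=> t.
    have t0 : 0 <= t by near: t; exact: nbhs_pinfty_ge.
    by case: (posF t t0).
  - move=> c f g bf bg; apply: cvg_lim => //.
    apply: cvg_trans (cvgD (cvgM (cvg_cst c) (cF f bf)) (cF g bg)).
    apply: near_eq_cvg; near=> t.
    have t0 : 0 <= t by near: t; exact: nbhs_pinfty_ge.
    by case: (posF t t0) => _ ->.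
  - move=> f g bf bg fg; apply: ler_lim; [exact: cF|exact: cF|near=> t].
    have t0 : 0 <= t by near: t; exact: nbhs_pinfty_ge.
    exact: (posfun_le (posF t t0)).
have tL : tight L.
  apply: tight_laplace => // e e0; have [d d0 Hd] := lam0 e e0; exists d => //.
  rewrite /L (cvg_lim _ (nulam _ _))//; by split => /=; exact: ltW.
have [mu [muD muL]] := riesz_representation posL tL.
by exists mu; split=> // f bf; rewrite muL//; exact: cF.
Unshelve. all: by end_near. Qed.

Lemma EFin_laplace (mu : {measure set (R * R)%type -> \bar R}) l :
  mu D = 1%E -> D l -> (\int[mu]_(y in D) expR (- dotp y l))%:E = laplace mu l.
Proof. by move=> muD Dl; rewrite EFin_Rintegral_bcont//; exact: bcont_expdot. Qed.

Lemma cvg_Rintegral_bcont (mu : {measure set (R * R)%type -> \bar R})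
    (u : nat -> R * R -> R) f M :
  mu D = 1%E -> (forall n, bcont (u n)) -> bcont f ->
  (forall n y, D y -> `|u n y| <= M) ->
  (forall y, D y -> u n y @[n --> \oo] --> f y) ->
  \int[mu]_(y in D) u n y @[n --> \oo] --> \int[mu]_(y in D) f y.
Proof.
move=> muD bu bf uM uf; have mD := @measurable_orthant R.
have mb g : bcont g -> measurable_fun D (EFin \o g).
  by move=> [cg _]; apply/measurable_EFinP; apply: measurable_funTS;
    exact: continuous_measurable2.
apply: fine_cvg; rewrite EFin_Rintegral_bcont//.
have [|||||_ _ //] := @dominated_convergence _ _ _ mu D mD
  (fun n y => (u n y)%:E) (fun y => (f y)%:E) (fun=> M%:E).
- by move=> n; exact: mb.
- exact: mb.
- by apply: aeW => y Dy; apply: cvg_EFin; [exact: nearW|exact: uf].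
- exact: (integrable_bcont muD (bcont_cst M)).
- by apply: aeW => y n Dy /=; rewrite lee_fin uM.
Qed.

(** Dominated convergence along [d = 1 / (n + 1)]. *)
Lemma laplace_near0 (mu : probability (R * R)%type R) e : mu D = 1%E -> 0 < e ->
  exists2 d, 0 < d & 1 - e <= \int[mu]_(y in D) expR (- dotp y (d, d)).
Proof.
move=> muD e0; have mD := @measurable_orthant R.
have Dn n : D (n.+1%:R^-1 : R, n.+1%:R^-1 : R) by split => /=; rewrite invr_ge0.
pose u (n : nat) (y : R * R) := expR (- dotp y (n.+1%:R^-1, n.+1%:R^-1)).
have H : \int[mu]_(y in D) u n y @[n --> \oo] --> (1 : R).
  rewrite -(posfun_cst (posfun_Rintegral muD) 1).
  apply: (@cvg_Rintegral_bcont mu u (cst 1) 1) => //.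
  - by move=> n; apply: bcont_expdot.
  - exact: bcont_cst.
  - move=> n y Dy; rewrite ger0_norm ?expR_ge0// -expR0 ler_expR oppr_le0.
    exact: dotp_ge0.
  - move=> y Dy; rewrite /= -expR0.
    have c : - dotp y (n.+1%:R^-1, n.+1%:R^-1) @[n --> \oo] --> (0 : R).
      rewrite -oppr0; apply: cvgN; rewrite /dotp /=.
      have -> : (fun n : nat => y.1 / n.+1%:R + y.2 / n.+1%:R) =
          (fun n => (y.1 + y.2) * harmonic n).
        by apply/funext => n; rewrite /harmonic /=; ring.
      by rewrite -(mulr0 (y.1 + y.2)); apply: cvgM;
        [exact: cvg_cst|exact: cvg_harmonic].
    exact: (cvg_comp _ _ c (@continuous_expR R 0)).
have /filter_ex [n /ltW Hn] := cvgr_gt _ H (1 - e) ltac:(lra).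
by exists n.+1%:R^-1 => //; rewrite invr_gt0.
Qed.

(** The integrals agree on exponential polynomials, hence by approximation on [bcont]; each measure
    is the outer measure of its integral. *)
Theorem laplace_unique (mu nu : probability (R * R)%type R) :
  mu D = 1%E -> nu D = 1%E -> (forall l, D l -> laplace mu l = laplace nu l) ->
  forall A, measurable A -> mu A = nu A.
Proof.
move=> muD nuD mn A mA.
have posm := posfun_Rintegral muD; have posn := posfun_Rintegral nuD.
have mnE l : D l -> \int[mu]_(y in D) expR (- dotp y l) = \int[nu]_(y in D) expR
  (- dotp y l).
  by move=> Dl; apply: EFin_inj; rewrite !EFin_laplace// mn.
have mnP P : expoly P -> \int[mu]_(y in D) P y = \int[nu]_(y in D) P y.
  elim=> [c j k|P1 P2 /bcont_expoly b1 H1 /bcont_expoly b2 H2].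
    have bjk : bcont (@expmono R j k) by apply: bcont_expdot; split => /=.
    by rewrite (posfunZ posm)// (posfunZ posn)// mnE//; split => /=.
  by rewrite (posfunD posm)// (posfunD posn)// H1 H2.
have mnf f : bcont f -> \int[mu]_(y in D) f y = \int[nu]_(y in D) f y.
  move=> bf; apply/eqP; rewrite -subr_eq0 -normr_le0; apply/ler_addgt0Pr => e e0.
  have [M M0 HM] := posfun_approx bf.
  have eM : 0 < e / 4 / M by rewrite !divr_gt0.
  have [d d0 Hd] := laplace_near0 muD eM.
  have [P [eP HP]] := HM d (e / 4) d0 ltac:(lra).
  have Dd : D (d, d) by split => /=; exact: ltW.
  have := HP _ posm; have := HP _ posn; rewrite (mnP P)// -mnE//.
  have H3 : M * (1 - \int[mu]_(y in D) expR (- dotp y (d, d))) <= e / 4.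
    have -> : e / 4 = M * (e / 4 / M) by field; rewrite gt_eqF.
    by rewrite ler_pM2l//; lra.
  by rewrite !ler_norml; lra.
have tight_of (m : probability (R * R)%type R) : m D = 1%E ->
    tight (fun f => \int[m]_(x in D) f x).
  move=> mD; apply: tight_laplace => [|e e0]; first exact: posfun_Rintegral.
  exact: laplace_near0.
transitivity (outer (fun f => \int[mu]_(x in D) f x) A).
  by apply: probability_outer => //; exact: tight_of.
transitivity (outer (fun f => \int[nu]_(x in D) f x) A); first exact: eq_outer.
by apply/esym; apply: probability_outer => //; exact: tight_of.
Qed.

End LaplaceTransform.

(** * The Riccati system *)

Section DriftMatrix.
Variables (R : realType) (b11 b12 b21 b22 : R).

Lemma eigenvalue_driftE z :
  eigenvalue (drift_mx b11 b12 b21 b22) z <-> (b11 - z) * (b22 - z) = b12 * b21.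
Proof.
set B := drift_mx _ _ _ _.
have mulB (v : 'rV[R]_2) : v *m B = z *: v <->
    v 0 0 * (b11 - z) = v 0 1 * b21 /\ v 0 1 * (b22 - z) = v 0 0 * b12.
  have E j : (v *m B) 0 j = v 0 0 * B 0 j + v 0 1 * B 1 j.
    rewrite mxE !big_ord_recl big_ord0 addr0 (_ : lift ord0 ord0 = 1)//.
    exact: val_inj.
  split=> [/rowP vB|[H1 H2]].
    have := vB 0; have := vB 1; rewrite !E !mxE /=; lra.
  apply/rowP => j; rewrite E !mxE; case: j => [[|[|//]]] i /=.
    by rewrite (_ : Ordinal i = 0); [lra|exact: val_inj].
  by rewrite (_ : Ordinal i = 1); [lra|exact: val_inj].
split=> [/eigenvalueP[v /mulB[H1 H2] v0]|H].
  have [v00|v00] := eqVneq (v 0 0) 0.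
    have v01 : v 0 1 != 0.
      apply: contraNneq v0 => v01; apply/eqP/rowP => j; rewrite mxE.
      case: j => [[|[|//]]] i.
        by rewrite (_ : Ordinal i = 0)//; exact: val_inj.
      by rewrite (_ : Ordinal i = 1)//; exact: val_inj.
    apply: (mulfI v01); move: H1 H2; rewrite v00 !mul0r => H1 H2.
    by rewrite mulrCA H2 mulr0 mulrCA -H1 mulr0.
  by apply: (mulfI v00); rewrite mulrA H1 mulrAC H2 mulrA.
pose vec (x y : R) : 'rV[R]_2 := \row_j (if j == 0 then x else y).
have vec0 x y : (vec x y) 0 0 = x by rewrite mxE.
have vec1 x y : (vec x y) 0 1 = y by rewrite mxE.
(* [(b22 - z, b12)] always solves the eigenvector equations and is nonzero unless [b12 = 0]. In that
   triangular case [(1, 0)] serves for [z = b11] and [(b21, b11 - z)] otherwise. *)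
have [b120|b120] := eqVneq b12 0; last first.
  apply/eigenvalueP; exists (vec (b22 - z) b12).
    by apply/mulB; rewrite vec0 vec1; split; lra.
  by apply/negP => /eqP/rowP/(_ 1); rewrite vec1 mxE; exact/eqP.
have [b11z|b11z] := eqVneq (b11 - z) 0.
  apply/eigenvalueP; exists (vec 1 0).
    by apply/mulB; rewrite vec0 vec1 b11z b120 !mulr0 !mul0r.
  by apply/negP => /eqP/rowP/(_ 0); rewrite vec0 mxE; apply/eqP; exact: oner_neq0.
apply/eigenvalueP; exists (vec b21 (b11 - z)).
  by apply/mulB; rewrite vec0 vec1; split; [lra|rewrite H mulrC].
by apply/negP => /eqP/rowP/(_ 1); rewrite vec1 mxE; exact/eqP.
Qed.

Context (b11_gt0 : 0 < b11) (b22_gt0 : 0 < b22).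
Context (b12_ge0 : 0 <= b12) (b21_ge0 : 0 <= b21).

(** If all eigenvalues are positive, so is the smaller root of the characteristic equation, which is
    real because the discriminant is nonnegative; this forces a positive determinant. Conversely,
    for [z <= 0] the product [(b11 - z) * (b22 - z)] is at least [b11 * b22]. *)
Lemma eigenvalue_drift_gt0 :
  (forall z, eigenvalue (drift_mx b11 b12 b21 b22) z -> 0 < z) <->
  b12 * b21 < b11 * b22.
Proof.
have bb0 : 0 <= b12 * b21 by exact: mulr_ge0.
split=> [H|H z /eigenvalue_driftE Ez]; last first.
  rewrite ltNge; apply/negP => z0.
  have h1 : 0 <= - z * b11 by rewrite mulr_ge0 ?oppr_ge0// ltW.
  have h2 : 0 <= - z * b22 by rewrite mulr_ge0 ?oppr_ge0// ltW.
  have h3 : 0 <= z * z by rewrite -expr2 sqr_ge0.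
  lra.
pose D := (b11 - b22) ^+ 2 + 4 * (b12 * b21).
have D0 : 0 <= D by rewrite addr_ge0 ?sqr_ge0// mulr_ge0.
have sD : Num.sqrt D ^+ 2 = D by rewrite sqr_sqrtr.
have s0 := sqrtr_ge0 D.
have /H z0 : eigenvalue (drift_mx b11 b12 b21 b22) ((b11 + b22 - Num.sqrt D) / 2).
  by apply/eigenvalue_driftE; move: sD; rewrite /D; lra.
move: sD; rewrite {2}/D; nra.
Qed.

End DriftMatrix.

(** * Derivatives on the half-line *)

Section OneSidedDerivative.
Variable R : realType.
Implicit Types (f : R -> R) (t l : R).

Lemma derive_on_nneg_cvg f t l : derive_on_nneg f t l ->
  f s @[s --> within `[0, +oo[ t^'] --> f t.
Proof.
move=> fl.
have ct : (s - t) @[s --> within `[0, +oo[ t^'] --> (0 : R).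
  apply: cvg_trans; first by apply: cvg_app; exact: cvg_within.
  apply: cvg_trans; first by apply: cvg_app; exact: cvg_within.
  by rewrite -(subrr t); apply: cvgB; [exact: cvg_id|exact: cvg_cst].
have H : (s - t) * ((s - t)^-1 * (f s - f t)) + f t
  @[s --> within `[0, +oo[ t^'] --> f t.
  rewrite [X in _ --> X](_ : _ = 0 * l + f t); last by rewrite mul0r add0r.
  by apply: cvgD; [exact: cvgM|exact: cvg_cst].
apply: cvg_trans H; apply: near_eq_cvg.
near=> s.
have st : s != t by near: s; apply: cvg_within; exact: withinT.
by rewrite mulrA divff ?subr_eq0// mul1r subrK.
Unshelve. all: by end_near. Qed.

Lemma derive_on_nneg_is_derive f t l : 0 < t -> derive_on_nneg f t l ->
  is_derive t 1 f l.
Proof.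
move=> t0 fl.
have H : (s - t)^-1 * (f s - f t) @[s --> t^'] --> l.
  apply: cvg_trans fl; apply: cvg_app => A wA.
  have wA' : t^' [set s | `[0, +oo[%classic s -> A s] by exact: wA.
  have t'0 : t^' [set s | 0 <= s].
    by apply: nbhs_dnbhs; near=> s; apply: ltW; near: s; exact: lt_nbhsr.
  by apply: filterS2 wA' t'0 => s H s0; apply: H; rewrite /= in_itv /= s0.
have c : h + t @[h --> 0^'] --> t^'.
  move=> A tA; have : \forall s \near t, s != t -> A s by exact: tA.
  rewrite (near_shift 0) subr0 => nA.
  suff : \forall h \near (0 : R), h != 0 -> A (h + t) by [].
  apply: filterS nA => h /= H' h0.
  by apply: H'; rewrite -subr_eq0 addrK.
have := cvg_comp _ _ c H; rewrite /comp => {}H.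
have E : (fun h => h^-1 *: (f (h *: 1 + t) - f t)) =
    (fun h => (h + t - t)^-1 * (f (h + t) - f t)).
  by apply/funext => h; rewrite addrK /GRing.scale /= mulr1.
split; first by rewrite /derivable; apply/cvg_ex; exists l; rewrite E.
by rewrite /derive; apply/cvg_lim => //; rewrite E.
Unshelve. all: by end_near. Qed.

(** The conclusion has the form that characterises continuity within [[0, +oo[]. *)
Lemma derive_on_nneg_continuous f (f' : R -> R) :
  (forall t, 0 <= t -> derive_on_nneg f t (f' t)) ->
  {in `]0, +oo[, continuous f} /\ f @ 0^'+ --> f 0.
Proof.
move=> df; split=> [t|].
  rewrite in_itv /= andbT => t0.
  have [dft _] := derive_on_nneg_is_derive t0 (df t (ltW t0)).
  exact/differentiable_continuous/derivable1_diffP.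
apply: cvg_trans (derive_on_nneg_cvg (df 0 (lexx 0))); apply: cvg_app => A wA.
have nA : \forall x \near (0 : R), x != 0 -> `[0, +oo[%classic x -> A x by exact: wA.
suff : \forall x \near (0 : R), 0 < x -> A x by [].
apply: filterS nA => x /= xA x0.
by apply: xA; [rewrite gt_eqF|rewrite in_itv /= ltW].
Qed.

End OneSidedDerivative.

(** * Lyapunov estimates for the cumulant functions *)

Section CumulantBounds.
Variables (R : realType) (a1 a2 b11 b12 b21 b22 s1 s2 : R).
Context (a1_gt0 : 0 < a1) (a2_gt0 : 0 < a2).
Context (b11_gt0 : 0 < b11) (b22_gt0 : 0 < b22).
Context (b12_ge0 : 0 <= b12) (b21_ge0 : 0 <= b21).
Context (det_gt0 : b12 * b21 < b11 * b22).
Local Notation leb := (@lebesgue_measure R).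

(* [c] solves [c B = A]; the quadratic terms of the Riccati equation being
   nonpositive, [<c, w>' <= - <A, w>] along every solution [w]. *)
Definition lyapunov : R * R :=
  ((a1 * b22 + a2 * b21) / (b11 * b22 - b12 * b21),
   (a1 * b12 + a2 * b11) / (b11 * b22 - b12 * b21)).

Lemma lyapunov_gt0 : 0 < lyapunov.1 /\ 0 < lyapunov.2.
Proof.
have d0 : 0 < b11 * b22 - b12 * b21 by rewrite subr_gt0.
by split; rewrite divr_gt0//; [apply: ltr_pwDl|apply: ltr_wpDl];
  rewrite ?mulr_ge0 ?mulr_gt0// ltW.
Qed.

Lemma lyapunov_drift (x : R * R) :
  lyapunov.1 * (- b11 * x.1 + b12 * x.2) + lyapunov.2 * (b21 * x.1 - b22 * x.2)
  = - dotp (a1, a2) x.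
Proof.
by rewrite /lyapunov /dotp /=; field; rewrite subr_eq0 gt_eqF.
Qed.

Section Solution.
Variables (l : R * R) (w : R -> R * R).
Context (w_sol : is_cumulant_solution b11 b12 b21 b22 s1 s2 l w).

Let rate t := dotp (a1, a2) (w t).
(** This is minus the derivative of [V], quadratic terms included. *)
Let loss t := rate t + (lyapunov.1 * (s1 ^+ 2 / 2 * (w t).1 ^+ 2)
                        + lyapunov.2 * (s2 ^+ 2 / 2 * (w t).2 ^+ 2)).
Let V t := dotp lyapunov (w t).

Lemma solution_orthant t : 0 <= t -> orthant (w t).
Proof. by move=> t0; case: (w_sol.2 t t0). Qed.

Let c1 : {in `]0, +oo[, continuous (fun s => (w s).1)} /\
  (w s).1 @[s --> 0^'+] --> (w 0).1.
Proof. by apply: derive_on_nneg_continuous => t t0; case: (w_sol.2 t t0) => _ H _;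
  exact: H. Qed.

Let c2 : {in `]0, +oo[, continuous (fun s => (w s).2)} /\
  (w s).2 @[s --> 0^'+] --> (w 0).2.
Proof. by apply: derive_on_nneg_continuous => t t0; case: (w_sol.2 t t0) => _ _ H;
  exact: H. Qed.

Let cont (F : R -> R -> R) : continuous (fun x : R * R => F x.1 x.2) ->
  {in `]0, +oo[, continuous (fun s => F (w s).1 (w s).2)} /\
  F (w s).1 (w s).2 @[s --> 0^'+] --> F (w 0).1 (w 0).2.
Proof.
move=> cF; split=> [t t0|].
  apply: (cvg_comp (fun s => ((w s).1, (w s).2)) (fun x : R * R => F x.1 x.2));
    last exact: cF.
  exact: (cvg_pair (c1.1 t t0) (c2.1 t t0)).
apply: (cvg_comp (fun s => ((w s).1, (w s).2)) (fun x : R * R => F x.1 x.2));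
  last exact: (cF ((w 0).1, (w 0).2)).
exact: (cvg_pair c1.2 c2.2).
Qed.

Let cfst (x : R * R) : y.1 @[y --> x] --> x.1. Proof. exact: cvg_fst. Qed.
Let csnd (x : R * R) : y.2 @[y --> x] --> x.2. Proof. exact: cvg_snd. Qed.

Let ccM c (f : R * R -> R) : continuous f -> continuous (fun x => c * f x).
Proof. by move=> cf x; apply: cvgM; [exact: cvg_cst|exact: cf]. Qed.

Let csqr (f : R * R -> R) : continuous f -> continuous (fun x => f x ^+ 2).
Proof. by move=> cf x; exact: (cvgM (cf x) (cf x)). Qed.

Let c_rate : {in `]0, +oo[, continuous rate} /\ rate @ 0^'+ --> rate 0.
Proof.
apply: (cont (F := fun x y => a1 * x + a2 * y)) => x.
by apply: cvgD; apply: ccM; [exact: cfst|exact: csnd].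
Qed.

Let c_V : {in `]0, +oo[, continuous V} /\ V @ 0^'+ --> V 0.
Proof.
apply: (cont (F := fun x y => lyapunov.1 * x + lyapunov.2 * y)) => x.
by apply: cvgD; apply: ccM; [exact: cfst|exact: csnd].
Qed.

Let c_loss : {in `]0, +oo[, continuous loss} /\ loss @ 0^'+ --> loss 0.
Proof.
apply: (cont (F := fun x y => a1 * x + a2 * y + (lyapunov.1 * (s1 ^+ 2 / 2 * x ^+ 2)
                        + lyapunov.2 * (s2 ^+ 2 / 2 * y ^+ 2)))) => x.
apply: cvgD; first by apply: cvgD; apply: ccM; [exact: cfst|exact: csnd].
by apply: cvgD; do 2 apply: ccM; apply: csqr; [exact: cfst|exact: csnd].
Qed.

Let within_itv (f : R -> R) (s t : R) : 0 <= s -> s < t ->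
  {in `]0, +oo[, continuous f} /\ f @ 0^'+ --> f 0 ->
  {within `[s, t], continuous f}.
Proof.
move=> s0 st [cf cf0].
have : {within `[0, +oo[, continuous f} by apply/continuous_within_itvcyP.
apply: continuous_subspaceW => x /=; rewrite !in_itv /= andbT => /andP[+ _].
exact: le_trans.
Qed.

Lemma measurable_rate :
  measurable_fun (`[0, +oo[ : set R) (fun s => (dotp (a1, a2) (w s))%:E).
Proof.
apply/measurable_EFinP; apply: subspace_continuous_measurable_fun => //.
exact/continuous_within_itvcyP.
Qed.

Let rate_ge0 t : 0 <= t -> 0 <= rate t.
Proof. by move=> t0; apply: dotp_ge0;
  [split => /=; exact: ltW|exact: solution_orthant]. Qed.

Let V_ge0 t : 0 <= t -> 0 <= V t.
Proof.
move=> t0; apply: dotp_ge0; last exact: solution_orthant.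
by have [/ltW ? /ltW ?] := lyapunov_gt0.
Qed.

Let rate_le_loss t : 0 <= t -> rate t <= loss t.
Proof.
move=> t0; rewrite /loss lerDl; have [/ltW p1 /ltW p2] := lyapunov_gt0.
by rewrite addr_ge0// mulr_ge0// mulr_ge0 ?sqr_ge0// divr_ge0 ?sqr_ge0.
Qed.

Let integral_loss s t : 0 <= s -> s < t ->
  (\int[leb]_(x in `[s, t]) (loss x)%:E = (V s - V t)%:E)%E.
Proof.
move=> s0 st.
have NVE (x : R) : x \in `]s, t[ -> is_derive x (1 : R) (fun y => - V y : R) (loss x).
  rewrite in_itv /= => /andP[sx xt].
  have x0 : 0 < x by exact: le_lt_trans s0 sx.
  have [Dw d1 d2] := w_sol.2 x (ltW x0).
  have D1 := derive_on_nneg_is_derive x0 d1.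
  have D2 := derive_on_nneg_is_derive x0 d2.
  have := is_deriveN (is_deriveD (is_deriveZ lyapunov.1 D1) (is_deriveZ lyapunov.2 D2)).
  rewrite (_ : - (_ + _) = loss x); last first.
    have := lyapunov_drift (w x); rewrite /loss /rate /dotp.
    set c1' := lyapunov.1; set c2' := lyapunov.2; rewrite /GRing.scale /=; lra.
  exact.
have := @continuous_FTC2 R loss (fun y => - V y) s t st (within_itv s0 st c_loss).
have cNV : {within `[s, t], continuous (fun y => - V y)}.
  apply: within_itv => //; case: c_V => cV cV0; split; last exact: cvgN.
  by move=> x x0; apply: cvgN; exact: cV.
move=> ->; first by rewrite -EFinB opprK addrC.
  have [_ cs ct] := (continuous_within_itvP _ st).1 cNV.
  split; [|exact: cs|exact: ct] => x xst.
  exact: (@ex_derive _ _ _ _ _ _ _ (NVE x xst)).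
move=> x xst; rewrite derive1E.
exact: (@derive_val _ _ _ _ _ _ _ (NVE x xst)).
Qed.

Let V_noninc s t : 0 <= s -> s < t -> V t <= V s.
Proof.
move=> s0 st; rewrite -subr_ge0 -lee_fin -integral_loss//.
apply: integral_ge0 => x /=; rewrite in_itv /= => /andP[sx _].
have x0 := le_trans s0 sx.
by rewrite lee_fin; apply: le_trans (rate_le_loss x0); exact: rate_ge0.
Qed.

Let sub0 t : (`[0, t] : set R) `<=` `[0, +oo[.
Proof. by move=> x /=; rewrite !in_itv /= andbT => /andP[]. Qed.

(** Since [rate <= loss], the integral is at most [V 0 - V t], and [V t] is nonnegative. *)
Lemma integral_rate_le t : 0 <= t ->
  (\int[leb]_(x in `[0%R, t]) (dotp (a1, a2) (w x))%:E
     <= (dotp lyapunov l)%:E)%E.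
Proof.
have V0 : V 0 = dotp lyapunov l by rewrite /V w_sol.1.
rewrite le_eqVlt => /predU1P[<-|t0].
  rewrite set_itv1 integral_set1 lee_fin -V0; exact: V_ge0.
apply: (@le_trans _ _ (\int[leb]_(x in `[0%R, t]) (loss x)%:E)%E).
  apply: ge0_le_integral => //=.
  - by move=> x /=; rewrite in_itv /= => /andP[x0 _]; rewrite lee_fin rate_ge0.
  - exact: measurable_funS (sub0 (t := t)) measurable_rate.
  - apply/measurable_EFinP; apply: subspace_continuous_measurable_fun => //.
    exact: within_itv.
  - by move=> x /=; rewrite in_itv /= => /andP[x0 _]; rewrite lee_fin rate_le_loss.
by rewrite integral_loss// lee_fin V0 gerBl V_ge0// ltW.
Qed.

(** The largest constant with [k * c <= A] coordinatewise, [c] being [lyapunov]. *)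
Let k := Num.min (a1 / lyapunov.1) (a2 / lyapunov.2).

Let k_gt0 : 0 < k.
Proof. by have [p1 p2] := lyapunov_gt0; rewrite /k lt_min; apply/andP; split;
  exact: divr_gt0. Qed.

Let kV_le_rate t : 0 <= t -> k * V t <= rate t.
Proof.
move=> /solution_orthant[w1 w2]; have [p1 p2] := lyapunov_gt0.
rewrite /V /rate /dotp mulrDr; apply: lerD; rewrite [leLHS]mulrA;
  apply: ler_wpM2r => //.
  by rewrite -ler_pdivlMr// /k ge_min lexx.
by rewrite -ler_pdivlMr// /k ge_min lexx orbT.
Qed.

(** As [V] is nonincreasing and [k * V <= rate], the quantity [k * t * V t] is at most the integral
    of [rate] over [[0, t]]. *)
Lemma V_decay t : 0 < t -> V t <= dotp lyapunov l / (k * t).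
Proof.
move=> t0; rewrite ler_pdivlMr ?mulr_gt0//.
rewrite -lee_fin; apply: le_trans (integral_rate_le (ltW t0)).
apply: (@le_trans _ _ (\int[leb]_(x in `[0%R, t]) (k * V t)%:E)%E).
  rewrite integral_cst//= lebesgue_measure_itv /= lte_fin t0 -EFinB subr0 -EFinM.
  by rewrite lee_fin (mulrC (V t)) mulrAC.
apply: ge0_le_integral => //=.
- by move=> x _; rewrite lee_fin mulr_ge0 ?V_ge0// ltW.
- exact: measurable_funS (sub0 (t := t)) measurable_rate.
- move=> x /=; rewrite in_itv /= => /andP[x0 xt]; rewrite lee_fin.
  apply: le_trans (kV_le_rate x0); rewrite ler_pM2l//.
  by move: xt; rewrite le_eqVlt => /predU1P[->//|xt]; exact: V_noninc.
Qed.

Lemma solution_cvg0 :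
  (w t).1 @[t --> +oo] --> (0 : R) /\ (w t).2 @[t --> +oo] --> (0 : R).
Proof.
have [p1 p2] := lyapunov_gt0.
have cst (c : R) : c * t^-1 @[t --> +oo] --> (0 : R).
  rewrite -(mulr0 c); apply: cvgM; first exact: cvg_cst.
  by apply/(gtr0_cvgV0 (f := id)) => //; exact: nbhs_pinfty_gt.
suff H (p : R) (u : R -> R) : 0 < p ->
    (forall t, 0 <= t -> 0 <= u t /\ p * u t <= V t) -> u t @[t --> +oo] --> (0 : R).
  split; [apply: (H lyapunov.1)|apply: (H lyapunov.2)] => // t t0;
  have [w1 w2] := solution_orthant t0; split=> //.
    by rewrite /V /dotp lerDl mulr_ge0// ltW.
  by rewrite /V /dotp lerDr mulr_ge0// ltW.
move=> p0 Hu.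
apply: (squeeze_cvgr _ (cvg_cst 0) (cst (dotp lyapunov l / k / p))).
near=> t.
have t0 : 0 < t by near: t; exact: nbhs_pinfty_gt.
have [-> /=] := Hu t (ltW t0); rewrite -ler_pdivlMl// => /le_trans; apply.
rewrite mulrC ler_pdivrMr//; apply: le_trans (V_decay t0) _ => //.
rewrite le_eqVlt; apply/orP; left; apply/eqP.
by field; rewrite !gt_eqF.
Unshelve. all: by end_near. Qed.

End Solution.
End CumulantBounds.

(** * The semigroup *)

Lemma measure_probability d (T : measurableType d) (R : realType)
    (m : {measure set T -> \bar R}) : m setT = 1%E ->
  exists P : probability T R, forall U, P U = m U.
Proof.
move=> mT; exists (mnormalize m (\d_point : probability T R)) => U.
by rewrite /= /mnormalize mT gt_eqF ?lte01//= invr1 mule1.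
Qed.

(** * Mixtures of kernels and extension from the quadrant *)

Section Mixtures.
Variable R : realType.
Local Notation D := (@orthant R).
Local Notation T := (R * R)%type.

Lemma ge0_integral_orthant (m : {measure set T -> \bar R}) (g : T -> \bar R) :
  m setT = 1%E -> m D = 1%E -> measurable_fun setT g -> (forall x, 0 <= g x)%E ->
  (\int[m]_(x in D) g x = \int[m]_x g x)%E.
Proof.
move=> mT mD1 mg g0; have mD := @measurable_orthant R.
rewrite (@ge0_negligible_integral _ _ _ m setT (~` D))//.
- by rewrite setDE setCK setTI.
- exact: measurableC.
have mToo : (m setT < +oo)%E by rewrite mT ltry.
have -> : (~` D) = setT `\` D by rewrite setTD.
have := measureD measurableT mD mToo.
rewrite setTI [X in (X - _)%E]mT [X in (_ - X)%E]mD1 => ->.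
by rewrite subee.
Qed.

(** On measurable sets [m] is the composition of the kernels [l] and [k], for which integrals
    iterate. The source [X] is arbitrary so that a single law can enter as a kernel from [unit]. *)
Lemma integral_mixture dX (X : measurableType dX) (l : R.-pker X ~> T)
    (k : R.-pker T ~> T) (x : X) (m : {measure set T -> \bar R}) (g : T -> \bar R) :
  l x D = 1%E ->
  (forall U, measurable U -> m U = \int[l x]_(y in D) k y U)%E ->
  measurable_fun setT g -> (forall y, 0 <= g y)%E ->
  (\int[m]_y g y = \int[l x]_(y in D) \int[k y]_z g z)%E.
Proof.
move=> lD mE mg g0.
have lT : l x setT = 1%E by exact: prob_kernel.
pose K : X * T -> {measure set T -> \bar R} := kernel.kernel_snd k.
have mk U : measurable U -> measurable_fun setT (k ^~ U) by exact: measurable_kernel.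
transitivity (\int[kcomp l (kernel.kernel_snd k) x]_y g y)%E.
  apply: eq_measure_integral => U mU _.
  by rewrite mE// ge0_integral_orthant//; exact: mk.
rewrite integral_kcomp// ge0_integral_orthant//.
- apply: measurable_fun_integral_kernel => //.
- by move=> y; exact: integral_ge0.
Qed.

(** Composition with the retraction of the plane onto the quadrant extends a test function that is
    continuous only there. *)
Lemma continuous_retract f : {within D, continuous f} ->
  continuous (fun y : T => f (Num.max 0 y.1, Num.max 0 y.2) : R).
Proof.
move=> /subspace_continuousP cf y.
pose p (z : T) := (Num.max 0 z.1, Num.max 0 z.2).
have Dp z : D (p z) by split; rewrite /= le_max lexx.
have cp : continuous p.
  apply: continuous_pair => z.
    apply: (@continuous_max _ _ (fun=> 0) fst); [exact: cst_continuous|exact: cvg_fst].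
  apply: (@continuous_max _ _ (fun=> 0) snd); [exact: cst_continuous|exact: cvg_snd].
have cpD : p z @[z --> y] --> within D (nbhs (p y)).
  move=> A wA; have nA : \forall z \near p y, D z -> A z by exact: wA.
  have H : \forall z \near y, D (p z) -> A (p z) := cp y _ nA.
  suff : \forall z \near y, A (p z) by [].
  by apply: filterS H => z; apply; exact: Dp.
exact: (cvg_comp _ _ cpD (cf (p y) (Dp y))).
Qed.

Lemma retractE (x : T) : D x -> (Num.max 0 x.1, Num.max 0 x.2) = x.
Proof. by case: x => x1 x2 [/= x10 x20]; rewrite !max_r. Qed.

End Mixtures.

(** * Long-time behaviour of the semigroup *)

Section CBISemigroup.
Variables (R : realType) (a1 a2 b11 b12 b21 b22 s1 s2 : R).
Context (a1_gt0 : 0 < a1) (a2_gt0 : 0 < a2)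
  (b11_gt0 : 0 < b11) (b22_gt0 : 0 < b22)
  (b12_ge0 : 0 <= b12) (b21_ge0 : 0 <= b21) (det_gt0 : b12 * b21 < b11 * b22).
Variables (v : R -> R * R -> R * R) (Q : R -> R.-pker (R * R) ~> (R * R)%type).
Context
  (v_sol : forall l, orthant l -> is_cumulant_solution b11 b12 b21 b22 s1 s2 l (v ^~ l))
  (Q_cbi : is_cbi_semigroup (a1, a2) v Q).
Local Notation D := (@orthant R).
Local Notation leb := (@lebesgue_measure R).
Local Notation A := (a1, a2).
Local Notation c := (lyapunov a1 a2 b11 b12 b21 b22).

Lemma cumulant_orthant t l : 0 <= t -> D l -> D (v t l).
Proof. by move=> t0 Dl; exact: (solution_orthant (v_sol Dl)). Qed.

Let rate_ge0 t l : 0 <= t -> D l -> 0 <= dotp A (v t l).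
Proof. by move=> t0 Dl; apply: dotp_ge0;
  [split => /=; exact: ltW|exact: cumulant_orthant]. Qed.

Let measurable_rate l : D l ->
  measurable_fun (`[0, +oo[ : set R) (fun s => (dotp A (v s l))%:E).
Proof. by move=> Dl; exact: (measurable_rate a1 a2 (v_sol Dl)). Qed.

Let sub0 t : (`[0, t] : set R) `<=` `[0, +oo[.
Proof. by move=> x /=; rewrite !in_itv /= andbT => /andP[]. Qed.

Definition immigration (t : R) (l : R * R) : R :=
  fine (\int[leb]_(s in `[0%R, t]) (dotp A (v s l))%:E)%E.

Let immigration_integral_ge0 (t : R) l : D l ->
  (0 <= \int[leb]_(s in `[0%R, t]) (dotp A (v s l))%:E)%E.
Proof.
move=> Dl; apply: integral_ge0 => s /=; rewrite in_itv /= => /andP[s0 _].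
by rewrite lee_fin rate_ge0.
Qed.

Let immigration_integral_le (t : R) l : D l ->
  (\int[leb]_(s in `[0%R, t]) (dotp A (v s l))%:E <= (dotp c l)%:E)%E.
Proof.
move=> Dl; have [t0|t0] := leP 0 t;
  first exact: (integral_rate_le _ _ _ _ _ _ _ (v_sol Dl)).
(* For negative [t] the interval is empty and the integral is 0. *)
rewrite set_itv_ge ?integral_set0; last by rewrite bnd_simp -ltNge.
rewrite lee_fin; apply: dotp_ge0 => //.
by have [] := @lyapunov_gt0 R a1 a2 b11 b12 b21 b22 => // ? ?; split; exact: ltW.
Qed.

Lemma EFin_immigration (t : R) l : D l ->
  (immigration t l)%:E = (\int[leb]_(s in `[0%R, t]) (dotp A (v s l))%:E)%E.
Proof.
move=> Dl; rewrite /immigration fineK// ge0_fin_numE ?immigration_integral_ge0//.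
by apply: le_lt_trans (immigration_integral_le t Dl) _; rewrite ltry.
Qed.

Lemma immigration_le t l : D l -> immigration t l <= dotp c l.
Proof. by move=> Dl; rewrite -lee_fin EFin_immigration// immigration_integral_le. Qed.

Lemma immigration_nondecreasing l : D l -> nondecreasing_fun (immigration ^~ l).
Proof.
move=> Dl s t st; rewrite -lee_fin !EFin_immigration//.
apply: ge0_subset_integral => //=.
- exact: measurable_funS (sub0 (t := t)) (measurable_rate Dl).
- by move=> x /=; rewrite in_itv /= => /andP[x0 _]; rewrite lee_fin rate_ge0.
- by apply: subset_itvl; rewrite bnd_simp.
Qed.

Definition total_immigration l := sup (range (immigration ^~ l)).

Lemma immigration_cvg l : D l -> immigration t l @[t --> +oo] --> total_immigration l.
Proof.
move=> Dl; apply: nondecreasing_cvgr; first exact: immigration_nondecreasing.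
by exists (dotp c l) => _ [t _ <-]; exact: immigration_le.
Qed.

Lemma total_immigration_le l : D l -> total_immigration l <= dotp c l.
Proof.
move=> Dl; apply: ge_sup; first by exists (immigration 0 l), 0.
by move=> _ [t _ <-]; exact: immigration_le.
Qed.

(** Monotone convergence along the intervals [[0, n]]. *)
Lemma EFin_total_immigration l : D l ->
  (total_immigration l)%:E = (\int[leb]_(s in `[0%R, +oo[) (dotp A (v s l))%:E)%E.
Proof.
move=> Dl.
have H : (\int[leb]_(s in `[0%R, (0 + n%:R)%R]) (dotp A (v s l))%:E)%E @[n --> \oo] -->
    (\int[leb]_(s in \bigcup_n `[0%R, (0 + n%:R)%R]%classic) (dotp A (v s l))%:E)%E.
  apply: ge0_nondecreasing_set_cvg_integral => //.
  - by move=> m n mn; apply/subsetPset; apply: subset_itvl;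
      rewrite bnd_simp lerD2l ler_nat.
  - by move=> n; exact: measurable_funS (sub0 (t := _)) (measurable_rate Dl).
  - by move=> n x /=; rewrite in_itv /= => /andP[x0 _]; rewrite lee_fin rate_ge0.
rewrite itv_bndy_bigcup_BRight; apply/esym; apply: (cvg_unique _ H) => //.
have -> : (fun n : nat => (\int[leb]_(s in `[0%R, (0 + n%:R)%R]) (dotp A (v s l))%:E)%E)
   = (fun n : nat => (immigration n%:R l)%:E).
  by apply/funext => n; rewrite EFin_immigration// add0r.
apply: cvg_EFin; first exact: nearW.
exact: (cvg_comp _ _ cvgr_idn (immigration_cvg Dl)).
Qed.

Lemma laplace_cbi t x l : 0 <= t -> D x -> D l ->
  laplace (Q t x) l = (expR (- dotp x (v t l) - immigration t l))%:E.
Proof. by move=> t0 Dx Dl; rewrite (Q_cbi.2 t x l)// -EFin_immigration. Qed.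

Definition limit_laplace l := expR (- total_immigration l).

Lemma cumulant_dotp_cvg0 x l : D l -> dotp x (v t l) @[t --> +oo] --> 0.
Proof.
move=> Dl;
  have [w1 w2] := solution_cvg0 a1_gt0 a2_gt0 b11_gt0 b22_gt0 b12_ge0 b21_ge0 det_gt0
    (v_sol Dl).
rewrite -[X in _ --> X](_ : x.1 * 0 + x.2 * 0 = _); last by rewrite !mulr0 addr0.
by apply: cvgD; apply: cvgM => //; exact: cvg_cst.
Qed.

Lemma laplace_cbi_cvg x l : D x -> D l ->
  \int[Q t x]_(y in D) expR (- dotp y l) @[t --> +oo] --> limit_laplace l.
Proof.
move=> Dx Dl.
have H : - dotp x (v t l) - immigration t l @[t --> +oo] --> - total_immigration l.
  rewrite -[X in _ --> X]add0r -[X in _ --> X + _]oppr0; apply: cvgB.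
    by apply: cvgN; exact: cumulant_dotp_cvg0.
  exact: immigration_cvg.
have := cvg_comp _ _ H (@continuous_expR R (- total_immigration l)).
apply: cvg_trans; apply: near_eq_cvg; near=> t.
have t0 : 0 <= t by near: t; exact: nbhs_pinfty_ge.
apply: EFin_inj; rewrite EFin_laplace// ?laplace_cbi//.
by case: Q_cbi => -[H1 _ _] _; exact: H1.
Unshelve. all: by end_near. Qed.

(** The Lyapunov bound at [(d, d)] is [d * (c.1 + c.2)], and [expR (- r) >= 1 - r]. *)
Lemma limit_laplace_near0 e : 0 < e -> exists2 d, 0 < d & 1 - e <= limit_laplace (d, d).
Proof.
move=> e0; have [c1 c2] : 0 < c.1 /\ 0 < c.2 by exact: lyapunov_gt0.
have c0 : 0 < c.1 + c.2 by exact: addr_gt0.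
have d0 : 0 < e / (c.1 + c.2) by exact: divr_gt0.
exists (e / (c.1 + c.2)) => //.
apply: le_trans (expR_ge1Dx _); rewrite lerD2l lerN2.
apply: le_trans (total_immigration_le _) _; first by split => /=; exact: ltW.
by rewrite /dotp -mulrDl mulrC divfK ?gt_eqF.
Qed.

(** The Laplace transform of [Q t y] is a constant times [expR (- dotp y (v t l))]; integrating over
    the starting law gives the product. This serves both the Chapman-Kolmogorov equation and
    stationary laws. *)
Lemma laplace_mixture dX (X : measurableType dX) (k : R.-pker X ~> (R * R)%type) x
    (m : {measure set (R * R)%type -> \bar R}) t l :
  0 <= t -> D l -> k x D = 1%E ->
  (forall U, measurable U -> m U = \int[k x]_(y in D) Q t y U)%E ->
  [/\ m setT = 1%E, m D = 1%E &
  laplace m l = ((expR (- immigration t l))%:E * laplace (k x) (v t l))%E].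
Proof.
move=> t0 Dl kD mE; have mD := @measurable_orthant R.
have QD y : D y -> Q t y D = 1%E by case: Q_cbi => -[H1 _ _] _; exact: H1.
have mT : m setT = 1%E.
  rewrite mE//; under eq_integral do rewrite prob_kernel.
  by rewrite integral_cst// mul1e.
have mD1 : m D = 1%E.
  rewrite mE// (eq_integral (cst 1%E)); first by rewrite integral_cst// mul1e.
  by move=> y; rewrite inE => /QD.
split=> //.
have me l' : measurable_fun setT (fun y : R * R => (expR (- dotp y l'))%:E).
  by apply/measurable_EFinP; apply: continuous_measurable2; exact: continuous_expdot.
have e0 l' (y : R * R) : (0 <= (expR (- dotp y l'))%:E)%E by rewrite lee_fin expR_ge0.
rewrite /laplace ge0_integral_orthant// (integral_mixture kD mE)//.
rewrite -ge0_integralZl ?lee_fin ?expR_ge0//; last exact: measurable_funTS.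
apply: eq_integral => y; rewrite inE => Dy.
rewrite -ge0_integral_orthant//; [|exact: prob_kernel|exact: QD].
by rewrite -/(laplace _ _) laplace_cbi// -EFinM -expRD addrC.
Qed.

Lemma orthant0 : D (0, 0).
Proof. by split. Qed.

(* The flow property, read off from the Chapman-Kolmogorov equation at 0. *)
Lemma limit_laplace_flow t l : 0 <= t -> D l ->
  limit_laplace l = expR (- immigration t l) * limit_laplace (v t l).
Proof.
move=> t0 Dl; have Dv := cumulant_orthant t0 Dl.
have dotp0 y : dotp (0, 0) y = 0 :> R by rewrite /dotp !mul0r addr0.
have H s : 0 <= s -> expR (- immigration (s + t) l) =
    expR (- immigration t l) * expR (- immigration s (v t l)).
  move=> s0; have [[QD _ CK] _] := Q_cbi.
  have [_ _] := laplace_mixture t0 Dl (QD s _ s0 orthant0)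
    (fun U mU => CK s t _ U s0 t0 orthant0 mU).
  rewrite (laplace_cbi (addr_ge0 s0 t0) orthant0 Dl) (laplace_cbi s0 orthant0 Dv).
  by rewrite !dotp0 !oppr0 !add0r -EFinM => -[].
have cst : s + t @[s --> +oo] --> +oo.
  apply/cvgryPge => M; near=> s; rewrite -lerBlDr; near: s.
  by apply: nbhs_pinfty_ge; exact: num_real.
have H1 : expR (- immigration (s + t) l) @[s --> +oo] --> limit_laplace l.
  apply: (cvg_comp (fun s => - immigration (s + t) l) (@expR R) _ (@continuous_expR R _)).
  by apply: cvgN; exact: (cvg_comp _ _ cst (immigration_cvg Dl)).
apply: (cvg_unique _ H1) => //.
have H2 : expR (- immigration t l) * expR (- immigration s (v t l)) @[s --> +oo] -->
    expR (- immigration t l) * limit_laplace (v t l).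
  apply: cvgM; first exact: cvg_cst.
  apply: (cvg_comp (fun s => - immigration s (v t l)) (@expR R) _ (@continuous_expR R _)).
  by apply: cvgN; exact: immigration_cvg.
apply: cvg_trans H2; apply: near_eq_cvg; near=> s.
by rewrite H//; near: s; exact: nbhs_pinfty_ge.
Unshelve. all: by end_near. Qed.

(** The limit is built separately for each [x]; its Laplace transform does not involve [x], so
    [laplace_unique] will identify all of them. *)
Lemma cbi_limit x : D x -> exists mu : probability (R * R)%type R,
  [/\ mu D = 1%E, forall l, D l -> laplace mu l = (limit_laplace l)%:E &
  forall f, bcont f -> \int[Q t x]_(y in D) f y @[t --> +oo] --> \int[mu]_(y in D) f y].
Proof.
move=> Dx; have [[QD _ _] _] := Q_cbi.
have [mu [muD muf]] := laplace_continuity (fun t t0 => QD t x t0 Dx)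
  (fun l Dl => laplace_cbi_cvg Dx Dl) limit_laplace_near0.
exists mu; split=> // l Dl; rewrite -EFin_laplace//; congr EFin.
exact: (cvg_unique _ (muf _ (bcont_expdot Dl)) (laplace_cbi_cvg Dx Dl)).
Qed.

End CBISemigroup.

Theorem theorem2p2 (R : realType)
    (a1 a2 b11 b12 b21 b22 s1 s2 : R)
    (a1_gt0 : 0 < a1) (a2_gt0 : 0 < a2)
    (b11_gt0 : 0 < b11) (b22_gt0 : 0 < b22)
    (s1_gt0 : 0 < s1) (s2_gt0 : 0 < s2)
    (b12_ge0 : 0 <= b12) (b21_ge0 : 0 <= b21)
    (v : R -> R * R -> R * R)
    (v_sol : forall l, orthant l ->
      is_cumulant_solution b11 b12 b21 b22 s1 s2 l (v ^~ l))
    (Q : R -> R.-pker (R * R) ~> (R * R)%type)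
    (Q_cbi : is_cbi_semigroup (a1, a2) v Q) :
  ((forall z : R, eigenvalue (drift_mx b11 b12 b21 b22) z -> 0 < z)
     <-> (b12 * b21) / (b11 * b22) < 1)
  /\
  ((forall z : R, eigenvalue (drift_mx b11 b12 b21 b22) z -> 0 < z) ->
   exists Qinf : probability (R * R)%type R,
     [/\ is_stationary Q Qinf,
         forall mu : probability (R * R)%type R, is_stationary Q mu ->
           forall U, measurable U -> mu U = Qinf U,
         forall l, orthant l ->
           laplace Qinf l =
           expeR (- \int[@lebesgue_measure R]_(s in `[0%R, +oo[)
                      (dotp (a1, a2) (v s l))%:E)%E &
         forall x, orthant x -> converges_weakly (fun t => Q t x) Qinf]).
Proof.
have eig := eigenvalue_drift_gt0 b11_gt0 b22_gt0 b12_ge0 b21_ge0.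
split; first by rewrite ltr_pdivrMr ?mulr_gt0// mul1r.
move=> /eig det_gt0.
have limit := cbi_limit a1_gt0 a2_gt0 b11_gt0 b22_gt0 b12_ge0 b21_ge0 det_gt0 v_sol
  Q_cbi.
have [Qinf [QinfD Qinfl Qinff]] := limit _ (orthant0 R).
have mix := laplace_mixture a1_gt0 a2_gt0 b11_gt0 b22_gt0 b12_ge0 b21_ge0 det_gt0
  v_sol Q_cbi.
have flow := limit_laplace_flow a1_gt0 a2_gt0 b11_gt0 b22_gt0 b12_ge0 b21_ge0 det_gt0
  v_sol Q_cbi.
have Dv t l : 0 <= t -> orthant l -> orthant (v t l) by move=> t0 Dl;
  exact: (cumulant_orthant v_sol).
(* A law viewed as a kernel from the one-point space, as the mixture lemma requires. *)
pose ker (m : probability (R * R)%type R) : R.-pker unit ~> (R * R)%type :=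
  kprobability (measurable_cst (m : pprobability (R * R)%type R)).
exists Qinf; split.
- split=> // t U t0 mU.
  (* The law at time [t] of the process started from [Qinf]. Its Laplace transform is that of [Qinf]
     by the flow identity. *)
  pose M : {measure set (R * R)%type -> \bar R} :=
    (mkcomp (ker Qinf) (kernel.kernel_snd (Q t)) tt).
  have ME U' : measurable U' -> M U' = (\int[Qinf]_(y in @orthant R) Q t y U')%E.
    move=> mU'; rewrite ge0_integral_orthant//; try exact: probability_setT;
      try exact: measurable_kernel.
  have [MT _ _] := mix _ _ (ker Qinf) tt M t _ t0 (orthant0 R) QinfD ME.
  have [P PM] := measure_probability MT.
  rewrite -ME// -PM; apply: laplace_unique => //.
    by rewrite PM;
      have [_ -> _] := mix _ _ (ker Qinf) tt M t _ t0 (orthant0 R) QinfD ME.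
  move=> l Dl; have [_ _] := mix _ _ (ker Qinf) tt M t l t0 Dl QinfD ME.
  rewrite (_ : laplace M l = laplace P l);
    last by apply: eq_measure_integral => U' _ _; rewrite [RHS]PM.
  move=> ->; rewrite (Qinfl l Dl) (flow t l t0 Dl) EFinM; congr (_ * _)%E.
  exact: Qinfl (Dv t l t0 Dl).
- move=> mu [muD mus]; apply: laplace_unique => // l Dl.
  have mixmu t (t0 : 0 <= t) :
      laplace mu l = ((expR (- immigration a1 a2 v t l))%:E * laplace mu (v t l))%E.
    by have [] := mix _ _ (ker mu) tt mu t l t0 Dl muD
      (fun U mU => esym (mus t U t0 mU)).
  have be l' := @bcont_expdot R l'.
  rewrite Qinfl// -EFin_laplace//; congr EFin.
  (* Stationarity is used at integer times [n]: since [v n l] tends to 0, dominated convergence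
     sends the second factor of [mixmu] to 1. *)
  pose u (n : nat) y := expR (- dotp y (v n%:R l)).
  have c1 : \int[mu]_(y in @orthant R) u n y @[n --> \oo] --> (1 : R).
    rewrite -(posfun_cst (posfun_Rintegral muD) 1).
    apply: (cvg_Rintegral_bcont (M := 1)) => //.
    + by move=> n; apply: be; exact: Dv.
    + exact: bcont_cst.
    + move=> n y Dy; rewrite ger0_norm ?expR_ge0// -expR0 ler_expR oppr_le0.
      by apply: dotp_ge0 => //; exact: Dv.
    + move=> y Dy; rewrite -expR0 -oppr0.
      apply: (cvg_comp (fun n : nat => - dotp y (v n%:R l)) (@expR R) _ (@continuous_expR R _)).
      apply: cvgN; apply: (cvg_comp _ (fun t => dotp y (v t l)) cvgr_idn).
      exact: (cumulant_dotp_cvg0 a1_gt0 a2_gt0 b11_gt0 b22_gt0 b12_ge0 b21_ge0 det_gt0 v_sol).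
  have c2 : expR (- immigration a1 a2 v n%:R l) @[n --> \oo] --> limit_laplace a1 a2
    v l.
    apply: (cvg_comp (fun n : nat => - immigration a1 a2 v n%:R l) (@expR R) _ (@continuous_expR R _)).
    apply: cvgN; apply: (cvg_comp _ (fun t => immigration a1 a2 v t l) cvgr_idn).
    exact: (immigration_cvg a1_gt0 a2_gt0 b11_gt0 b22_gt0 b12_ge0 b21_ge0 det_gt0 v_sol).
  have c3 : expR (- immigration a1 a2 v n%:R l) * \int[mu]_(y in @orthant R) u n y
    @[n --> \oo]
      --> limit_laplace a1 a2 v l by rewrite -[X in _ --> X]mulr1; exact: cvgM.
  apply: cvg_unique c3 => //.
  (* By [mixmu] the product does not depend on [n], so its limit is the Laplace transform of [mu] at
     [l]. *)
  apply: cvg_near_cst; apply: nearW => n; apply: EFin_inj.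
  have n0 : 0 <= n%:R :> R by exact: ler0n.
  by rewrite EFinM (EFin_laplace muD (Dv _ _ n0 Dl)) (EFin_laplace muD Dl) (mixmu _ n0).
- move=> l Dl;
    rewrite Qinfl//
      -(EFin_total_immigration a1_gt0 a2_gt0 b11_gt0 b22_gt0 b12_ge0 b21_ge0 det_gt0 v_sol)//.
- move=> x Dx f cf [M fM].
  pose g (y : R * R) := f (Num.max 0 y.1, Num.max 0 y.2).
  have bg : bcont g.
    split; first exact: continuous_retract.
    by exists M => y Dy; apply: fM; rewrite retractE.
  have fg (m : {measure set (R * R)%type -> \bar R}) :
      \int[m]_(y in @orthant R) f y = \int[m]_(y in @orthant R) g y.
    by apply: eq_Rintegral => y; rewrite inE => Dy; rewrite /g retractE.
  rewrite fg; under eq_fun do rewrite fg.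
  (* [Q t x] tends to its own limit [mu], which has the Laplace transform of [Qinf]. *)
  have [mu [muD mul muf]] := limit x Dx.
  rewrite (_ : \int[Qinf]_(y in @orthant R) g y = \int[mu]_(y in @orthant R) g y);
    first exact: muf.
  congr fine; apply: eq_measure_integral => U mU _.
  by apply: laplace_unique => // l Dl; rewrite Qinfl// mul.
Qed.
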